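(* Let $\Gamma$ be a finite graph and $\mathcal{G}=\{G_u\mid u\in V(\Gamma)\}$ a collection of non-trivial finitely generated groups. For every $u\in V(\Gamma)$, fix a finite generating set $S_u\subset G_u$. Set $S:=\bigcup_{u\in V(\Gamma)}S_u$. If the essential support of an element $g\in\Gamma\mathcal{G}$ is neither complete nor contained in a large join, then $g$ is contracting in $\mathrm{Cay}(\Gamma\mathcal{G},S)$.
   Context: The graph product is $\Gamma\mathcal{G}=\langle G_u\ (u\in V(\Gamma))\mid [G_u,G_v]=1\ (\{u,v\}\in E(\Gamma))\rangle$. A word is a product $g_1\cdots g_n$ of syllables, each $g_i$ in some vertex-group. Elementary moves: delete a trivial syllable; merge two consecutive syllables from the same vertex-group; exchange two consecutive syllables from adjacent vertex-groups. A word is graphically reduced if its length $n$ cannot be shortened by these moves; every element is represented by a graphically reduced word, unique up to exchanging commuting syllables, and its support is the subgraph of $\Gamma$ induced by the vertices whose groups contain its syllables. A word is cyclically graphically reduced if its length cannot be shortened by these moves together with cyclic permutations. Every $g$ has a conjugate represented by a cyclically graphically reduced word, and the support of such a conjugate is the essential support of $g$. (The empty graph and single vertices count as complete.) For an induced subgraph $\Lambda\subset\Gamma$, $\langle\Lambda\rangle$ denotes the subgroup generated by the vertex-groups of $\Lambda$. A join is a subgraph of $\Gamma$ that is the union of two non-empty disjoint induced subgraphs $\Lambda_1,\Lambda_2$ with every vertex of $\Lambda_1$ adjacent to every vertex of $\Lambda_2$; it is large if $\Lambda_1,\Lambda_2$ can be chosen so that $\langle\Lambda_1\rangle$ and $\langle\Lambda_2\rangle$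 are both infinite. Contracting: given a group acting by isometries on a metric space $(X,d)$, an element $g$ is contracting in $X$ if, for some (equivalently any) $o\in X$, the orbit map $n\mapsto g^n o$ is a quasi-isometric embedding $\mathbb{Z}\to X$ and there exists $D\geq 0$ such that for every ball $B\subset X$ disjoint from $\langle g\rangle\cdot o$, the nearest-point projection of $B$ on $\langle g\rangle\cdot o$ has diameter $\leq D$. The group acts on its Cayley graph by left multiplication. *)

(* Defs.v *)
From HB Require Import structures.
From Stdlib Require Import Relation_Operators.
From mathcomp Require Import all_boot all_order all_algebra generic_quotient.
From mathcomp Require Import boolp classical_sets cardinality reals topology.

Set Implicit Arguments.
Unset Strict Implicit.
Unset Printing Implicit Defensive.

Import Order.TTheory GRing.Theory Num.Theory.

Local Open Scope classical_set_scope.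
Local Open Scope quotient_scope.
Local Open Scope group_scope.

Definition is_subgroup (G : groupType) (A : set G) : Prop :=
  [/\ A 1, forall x y, A x -> A y -> A (x * y) & forall x, A x -> A x^-1].

Definition generated (G : groupType) (S : set G) : set G :=
  smallest (@is_subgroup G) S.

Definition generates (G : groupType) (S : set G) : Prop :=
  generated S = [set: G].

Lemma generated_subgroup (G : groupType) (S : set G) :
  is_subgroup (generated S).
Proof.
split=> [A [[]]//|x y Sx Sy A SA|x Sx A SA]; case: (SA) => -[_ AM AV] _.
  by apply: AM; [exact: Sx|exact: Sy].
by apply: AV; exact: Sx.
Qed.

Definition zexpg (G : groupType) (x : G) (n : int) : G :=
  match n with Posz k => x ^+ k | Negz k => x ^- k.+1 end.

Section GraphProduct.
Variables (V : finType) (e : rel V) (G : V -> groupType).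

Definition syllable : Type := {u : V & G u}.
HB.instance Definition _ := Choice.on syllable.

Definition syl (u : V) (a : G u) : syllable := Tagged (fun v => G v : Type) a.

Definition word : Type := seq syllable.
HB.instance Definition _ := Choice.on word.

Inductive emove : word -> word -> Prop :=
| EDelete (s t : word) (u : V) :
    emove (s ++ syl (1 : G u) :: t) (s ++ t)
| EMerge (s t : word) (u : V) (a b : G u) :
    emove (s ++ syl a :: syl b :: t) (s ++ syl (a * b) :: t)
| EExchange (s t : word) (u v : V) (a : G u) (b : G v) : e u v ->
    emove (s ++ syl a :: syl b :: t) (s ++ syl b :: syl a :: t).

Definition cmove (w w' : word) : Prop :=
  emove w w' \/ exists s t, w = s ++ t /\ w' = t ++ s.

Definition graphically_reduced (w : word) : Prop :=
  forall w', clos_refl_trans word emove w w' -> size w <= size w'.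

Definition cyclically_reduced (w : word) : Prop :=
  forall w', clos_refl_trans word cmove w w' -> size w <= size w'.

Definition vertices (w : word) : {set V} := [set u in map tag w].

(* The group presented by the multiplication tables of the vertex groups and
   the commutation relations; [graph_product_univ] is the universal property
   of this presentation. *)
Definition word_eq : rel word :=
  fun w w' => `[< clos_refl_sym_trans word emove w w' >].

Lemma word_eqP w w' :
  reflect (clos_refl_sym_trans word emove w w') (word_eq w w').
Proof. exact: asboolP. Qed.

Lemma word_eq_equiv : equiv_class_of word_eq.
Proof.
split=> [w|w w'|w2 w1 w3].
- exact/word_eqP/rst_refl.
- by apply/idP/idP => /word_eqP h; apply/word_eqP; exact: rst_sym.
- by move=> /word_eqP h /word_eqP h'; apply/word_eqP; exact: rst_trans h h'.
Qed.

Canonical word_eq_equivrel := EquivRelPack word_eq_equiv.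

Definition graph_product : Type := {eq_quot word_eq}.
HB.instance Definition _ := Choice.on graph_product.

Definition eval (w : word) : graph_product := \pi_({eq_quot word_eq}) w.

Lemma evalP w w' : eval w = eval w' <-> clos_refl_sym_trans word emove w w'.
Proof.
split=> [h|/word_eqP h]; last exact/eqmodP.
by apply/word_eqP; move/eqmodP: h.
Qed.

Lemma eval_surj (x : graph_product) : exists w, x = eval w.
Proof. by exists (repr x); rewrite /eval reprK. Qed.

Lemma eval_emove w w' : emove w w' -> eval w = eval w'.
Proof. by move=> h; apply/evalP/rst_step. Qed.

Lemma emove_cat s t w w' : emove w w' -> emove (s ++ w ++ t) (s ++ w' ++ t).
Proof.
case=> [l r u|l r u a b|l r u v a b uv]; rewrite -!catA /= !(catA s l);
  by constructor.
Qed.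

Lemma eval_cat s s' t t' :
  eval s = eval s' -> eval t = eval t' -> eval (s ++ t) = eval (s' ++ t').
Proof.
move=> /evalP ss' /evalP tt'; transitivity (eval (s' ++ t)).
  elim: ss' => [x y xy|//|x y _ ->//|x y z _ -> _ ->//].
  by apply: eval_emove; have := emove_cat [::] t xy.
elim: tt' => [x y xy|//|x y _ ->//|x y z _ -> _ ->//].
by apply: eval_emove; have := emove_cat s' [::] xy; rewrite !cats0.
Qed.

Definition word_inv (w : word) : word :=
  rev [seq let: existT u a := x in syl (a^-1 : G u) | x <- w].

Lemma eval_invl w : eval (word_inv w ++ w) = eval [::].
Proof.
elim: w => [//|[u a] w IHw]; rewrite /word_inv /= rev_cons cat_rcons.
rewrite (eval_emove (EMerge _ w a^-1 a)) mulVg.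
by rewrite (eval_emove (EDelete _ w u)).
Qed.

Lemma word_invK w : word_inv (word_inv w) = w.
Proof.
rewrite /word_inv map_rev revK -map_comp -[RHS]map_id.
by apply: eq_map => -[u a]; rewrite /= invgK.
Qed.

Lemma eval_invr w : eval (w ++ word_inv w) = eval [::].
Proof. by rewrite -{1}(word_invK w) eval_invl. Qed.

Let gp_mul (x y : graph_product) := eval (repr x ++ repr y).
Let gp_inv (x : graph_product) := eval (word_inv (repr x)).

Let eval_repr (x : graph_product) : eval (repr x) = x.
Proof. exact: reprK. Qed.

Let gp_mulE s t : gp_mul (eval s) (eval t) = eval (s ++ t).
Proof. by apply: eval_cat; rewrite eval_repr. Qed.

Let gp_mulA : associative gp_mul.
Proof.
move=> x y z; case: (eval_surj x) (eval_surj y) (eval_surj z).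
by move=> s -> [t ->] [r ->]; rewrite !gp_mulE catA.
Qed.

Let gp_mul1 : left_id (eval [::]) gp_mul.
Proof. by move=> x; case: (eval_surj x) => s ->; rewrite gp_mulE. Qed.

Let gp_1mul : right_id (eval [::]) gp_mul.
Proof. by move=> x; case: (eval_surj x) => s ->; rewrite gp_mulE cats0. Qed.

Let gp_mulV : left_inverse (eval [::]) gp_inv gp_mul.
Proof.
by move=> x; rewrite -{2}(eval_repr x) /gp_inv gp_mulE eval_invl.
Qed.

Let gp_Vmul : right_inverse (eval [::]) gp_inv gp_mul.
Proof.
by move=> x; rewrite -{1}(eval_repr x) /gp_inv gp_mulE eval_invr.
Qed.

HB.instance Definition _ :=
  isGroup.Build graph_product gp_mulA gp_mul1 gp_1mul gp_mulV gp_Vmul.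

Lemma evalM s t : eval (s ++ t) = eval s * eval t.
Proof. by rewrite -gp_mulE. Qed.

Lemma eval0 : eval [::] = 1.
Proof. by []. Qed.

Definition incl (u : V) (a : G u) : graph_product := eval [:: syl a].

Lemma inclM u : {morph @incl u : a b / a * b}.
Proof.
move=> a b; rewrite /incl -evalM.
by rewrite (eval_emove (EMerge [::] [::] a b)).
Qed.

Lemma incl1 u : incl (1 : G u) = 1.
Proof. by rewrite /incl (eval_emove (EDelete [::] [::] u)). Qed.

Lemma inclV u (a : G u) : incl a^-1 = (incl a)^-1.
Proof. by apply: (mulgI (incl a)); rewrite -inclM !mulgV incl1. Qed.

Lemma incl_commute u v (a : G u) (b : G v) :
  e u v -> commute (incl a) (incl b).
Proof.
move=> uv; rewrite /commute /incl -!evalM.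
exact: (eval_emove (EExchange [::] [::] a b uv)).
Qed.

Lemma eval_cons u (a : G u) w : eval (syl a :: w) = incl a * eval w.
Proof. by rewrite -evalM. Qed.

Definition vertex_group (u : V) : set graph_product := range (@incl u).

Definition parabolic (L : {set V}) : set graph_product :=
  generated (\bigcup_(u in [set u | u \in L]) vertex_group u).

Definition gp_gens (S : forall u, set (G u)) : set graph_product :=
  \bigcup_(u in [set: V]) (@incl u @` S u).

Lemma gp_gens_generates (S : forall u, set (G u)) :
  (forall u, generates (S u)) -> generates (gp_gens S).
Proof.
move=> genS; apply/seteqP; split=> // x _.
have [g1 gM gV] := generated_subgroup (gp_gens S).
have inclS u (a : G u) : generated (gp_gens S) (incl a).
  have : generated (S u) a by rewrite genS.
  move/(_ (@incl u @^-1` generated (gp_gens S))); apply; split.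
    split=> [|a1 a2|a1] /=; rewrite ?incl1 ?inclM ?inclV//; first exact: gM.
    exact: gV.
  move=> s Ss /=; apply: sub_gen_smallest; exists u => //; exact: imageP.
case: (eval_surj x) => w ->.
by elim: w => [|[u a] w IHw]; rewrite ?eval0// eval_cons; apply: gM.
Qed.

Lemma graph_product_univ (H : groupType) (f : forall u, G u -> H) :
    (forall u, {morph f u : a b / a * b}) ->
    (forall u v (a : G u) (b : G v), e u v -> commute (f u a) (f v b)) ->
  exists phi : graph_product -> H,
    [/\ {morph phi : x y / x * y}, forall u (a : G u), phi (incl a) = f u a &
      forall psi : graph_product -> H, {morph psi : x y / x * y} ->
        (forall u (a : G u), psi (incl a) = f u a) -> psi =1 phi].
Proof.
move=> fM fC.
have f1 u : f u 1 = 1 by apply: (mulgI (f u 1)); rewrite -fM !mulg1.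
pose F (w : word) : H := foldr (fun x h => f (tag x) (tagged x) * h) 1 w.
have FM s t : F (s ++ t) = F s * F t.
  by elim: s => [|x s IHs] /=; rewrite ?mul1g// IHs mulgA.
have Feq w w' : eval w = eval w' -> F w = F w'.
  move/evalP; elim=> {w w'} [w w'|//|x y _ ->//|x y z _ -> _ ->//].
  case=> [s t u|s t u a b|s t u v a b uv]; rewrite !FM /=.
  - by rewrite f1 mul1g.
  - by rewrite fM -mulgA.
  - by congr (_ * _); rewrite !mulgA (fC u v).
have FE w : F (repr (eval w)) = F w by apply: Feq; rewrite eval_repr.
exists (fun x => F (repr x)); split.
- move=> x y; case: (eval_surj x) (eval_surj y) => s -> [t ->].
  by rewrite -evalM !FE FM.
- by move=> u a; rewrite FE /= mulg1.
- move=> psi psiM psif x; case: (eval_surj x) => w ->; rewrite FE.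
  elim: w => [|[u a] w IHw].
    by rewrite eval0; apply: (mulgI (psi 1)); rewrite -psiM !mulg1.
  by rewrite eval_cons psiM psif IHw.
Qed.

Definition has_support (x : graph_product) (L : {set V}) : Prop :=
  exists w, [/\ graphically_reduced w, eval w = x & vertices w = L].

Definition has_essential_support (x : graph_product) (L : {set V}) : Prop :=
  exists y : graph_product,
    (exists w, cyclically_reduced w /\ eval w = x ^ y) /\
    has_support (x ^ y) L.

Lemma cmove_conj w w' : clos_refl_trans word cmove w w' ->
  exists y, eval w' = eval w ^ y.
Proof.
elim=> {w w'} [w w'|w|x y z _ [a ya] _ [b zb]].
- case=> [/eval_emove ->|[s [t [-> ->]]]]; first by exists 1; rewrite conjg1.
  by exists (eval s); rewrite !evalM conjgE -mulgA mulKg.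
- by exists 1; rewrite conjg1.
- by exists (a * b); rewrite zb ya conjgM.
Qed.

Lemma essential_support_ex (x : graph_product) :
  exists L, has_essential_support x L.
Proof.
case: (eval_surj x) => w0 ->.
have exP : exists n, `[< exists2 w, clos_refl_trans word cmove w0 w &
    size w = n >].
  by exists (size w0); apply/asboolP; exists w0 => //; exact: rt_refl.
case: (ex_minnP exP) => n /asboolP[w w0w <-{n}] wmin.
have wcr : cyclically_reduced w.
  move=> w' ww'; apply: wmin; apply/asboolP; exists w' => //.
  exact: rt_trans ww'.
have [y wy] := cmove_conj w0w; exists (vertices w), y.
split; first by exists w.
exists w; split=> // w' ww'; apply: wcr.
elim: ww' => [a b ab|a|a b c _ ab _ bc]; [|exact: rt_refl|exact: rt_trans bc].
by apply: rt_step; left.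
Qed.

Definition complete (L : {set V}) : Prop :=
  forall u v, u \in L -> v \in L -> u != v -> e u v.

Definition join_of (L1 L2 : {set V}) : Prop :=
  [/\ L1 != finset.set0, L2 != finset.set0, [disjoint L1 & L2]%B &
      forall u v, u \in L1 -> v \in L2 -> e u v].

Definition large_join (J : {set V}) : Prop :=
  exists L1 L2 : {set V},
    [/\ J = L1 :|: L2, join_of L1 L2, infinite_set (parabolic L1) &
        infinite_set (parabolic L2)].

End GraphProduct.

Section Contracting.
Local Open Scope ring_scope.

Record isometric_action (R : realType) (G : groupType) (X : metricType R) := {
  act :> G -> X -> X;
  act1 : forall x, act 1%g x = x;
  actM : forall g h x, act (g * h)%g x = act g (act h x);
  act_isom : forall g x y, mdist (act g x) (act g y) = mdist x y
}.

Variables (R : realType) (G : groupType) (X : metricType R).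
Variable rho : isometric_action G X.

Definition qi_embedding (f : int -> X) : Prop :=
  exists A B : R, [/\ 1 <= A, 0 <= B & forall m n : int,
    A^-1 * `|m - n|%:~R - B <= mdist (f m) (f n) <= A * `|m - n|%:~R + B].

Definition projection (Y A : set X) : set X :=
  [set p | Y p /\ exists2 x, A x & forall q, Y q -> mdist x p <= mdist x q].

Definition contracting (g : G) : Prop :=
  exists o : X,
    let orb (n : int) := rho (zexpg g n) o in
    qi_embedding orb /\
    exists2 D : R, 0 <= D & forall (x : X) (r : R),
      ball x r `&` range orb = set0 ->
      forall p q, projection (range orb) (ball x r) p ->
        projection (range orb) (ball x r) q -> mdist p q <= D.

End Contracting.

Section Cayley.
Variables (R : realType) (G : groupType) (S : set G).

Definition cayley_adj (x y : G) : Prop :=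
  exists2 s, S s & y = x * s \/ x = y * s.

Fixpoint cayley_walk (n : nat) (x y : G) : Prop :=
  if n is m.+1 then exists2 z, cayley_adj x z & cayley_walk m z y else x = y.

Lemma cayley_walk_cat m n x y z :
  cayley_walk m x y -> cayley_walk n y z -> cayley_walk (m + n) x z.
Proof.
elim: m x => [|m IHm] x /=; first by move=> ->.
by case=> t xt ty yz; exists t => //; exact: IHm yz.
Qed.

Lemma cayley_walk_sym n x y : cayley_walk n x y -> cayley_walk n y x.
Proof.
elim: n x => [|n IHn] x //= [z [s Ss xz] /IHn yz].
suff zx : cayley_walk 1 z x.
  by have := cayley_walk_cat yz zx; rewrite addn1.
by exists x => //; exists s => //; case: xz; [right|left].
Qed.

Lemma cayley_walk_mul g n x y :
  cayley_walk n x y -> cayley_walk n (g * x) (g * y).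
Proof.
elim: n x => [|n IHn] x /=; first by move=> ->.
case=> z [s Ss xz] /IHn zy; exists (g * z) => //; exists s => //.
by case: xz => ->; rewrite mulgA; [left|right].
Qed.

Lemma cayley_connected (genS : generates S) x y :
  exists n, `[< cayley_walk n x y >].
Proof.
suff con z : exists n, cayley_walk n 1 z.
  have [n] := con (x^-1 * y); move=> /(cayley_walk_mul x).
  by rewrite mulg1 mulVKg => xy; exists n; apply/asboolP.
have : generated S z by rewrite genS.
move/(_ [set z | exists n, cayley_walk n 1 z]); apply; split; last first.
  by move=> s Ss; exists 1%N => /=; exists s => //; exists s; rewrite ?mul1g; auto.
split=> [|a b [m wa] [n wb]|a [m wa]]; first by exists 0%N.
  exists (m + n)%N; apply: cayley_walk_cat wa _.
  by have := cayley_walk_mul a wb; rewrite mulg1.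
exists m; apply: cayley_walk_sym.
by have := cayley_walk_mul a^-1 wa; rewrite mulg1 mulVg.
Qed.

Hypothesis genS : generates S.

Definition cayley_dist (x y : G) : nat := ex_minn (cayley_connected genS x y).

Lemma cayley_distP x y : cayley_walk (cayley_dist x y) x y.
Proof. by rewrite /cayley_dist; case: ex_minnP => n /asboolP. Qed.

Lemma cayley_dist_min n x y : cayley_walk n x y -> cayley_dist x y <= n.
Proof.
by move=> /asboolP xy; rewrite /cayley_dist; case: ex_minnP => m _; apply.
Qed.

(* The metric space is the vertex set of the Cayley graph, with the graph
   metric; [R] and [genS] are phantom parameters on which that metric depends. *)
Definition cayley : Type := (fun (_ : realType) (_ : generates S) => G) R genS.
HB.instance Definition _ := Choice.on cayley.

Local Open Scope ring_scope.

Let dist (x y : cayley) : R := (cayley_dist x y)%:R.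

Let distxx x : dist x x = 0.
Proof.
have : (cayley_dist x x <= 0)%N by exact: cayley_dist_min.
by rewrite leqn0 /dist => /eqP ->.
Qed.

Let dist_pos x y : dist x y = 0 -> x = y.
Proof.
move=> /eqP; rewrite pnatr_eq0 => /eqP xy.
by have := cayley_distP x y; rewrite xy.
Qed.

Let dist_sym x y : dist x y = dist y x.
Proof.
have le a b : (cayley_dist a b <= cayley_dist b a)%N.
  exact/cayley_dist_min/cayley_walk_sym/cayley_distP.
by congr (_%:R); apply/eqP; rewrite eqn_leq !le.
Qed.

Let dist_triangle y x z : dist x z <= dist x y + dist y z.
Proof.
rewrite -natrD ler_nat; apply: cayley_dist_min.
by apply: cayley_walk_cat; exact: cayley_distP.
Qed.

HB.instance Definition _ :=
  isMetric.Build R cayley distxx dist_pos dist_sym dist_triangle.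

Lemma cayley_mdistE (x y : cayley) : mdist x y = (cayley_dist x y)%:R :> R.
Proof. by []. Qed.

Let lmul (g : G) (x : cayley) : cayley := (g * (x : G))%g.

Let lmul_isom g x y : mdist (lmul g x) (lmul g y) = mdist x y.
Proof.
have le h a b : (cayley_dist (h * a)%g (h * b)%g <= cayley_dist a b)%N.
  exact/cayley_dist_min/cayley_walk_mul/cayley_distP.
rewrite !cayley_mdistE; congr (_%:R); apply/eqP; rewrite eqn_leq le /=.
by have := le g^-1%g (g * x)%g (g * y)%g; rewrite !mulKg.
Qed.

Definition cayley_action : isometric_action G cayley :=
  @Build_isometric_action R G cayley lmul (@mul1g G)
    (fun g h x => esym (mulgA g h x)) lmul_isom.

End Cayley.

(* Main.v *)
(* Write [hd u x] for the [G u]-syllable that can be shuffled to the front of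
   [x] ([1] if there is none). A translate [z <star u>] is the carrier of a
   hyperplane whose sectors are the fibres of [x |-> hd u (z^-1 * x)], and an edge
   of the Cayley graph crosses it only inside the carrier.

   Conjugate [g] to a cyclically reduced word with support [L], and let [K] be a
   non-singleton component of [L] for non-adjacency. Then [g = h f] with [h]
   supported on [K] and [f] on the common link of [K]; this link generates a
   finite group, since otherwise [K] and its common link would form a large join.
   For [u] in [K] and [N] large, the carriers [z^k <star u>], [z = g^N], are
   linearly ordered, and the gate projection of one onto the preceding one lies in
   a translate of the finite group above. A geodesic crossing two consecutive
   hyperplanes therefore passes within bounded distance of the orbit of [g]. The
   number [k] of the last hyperplane met by [x] is thus a coarse projection to the
   orbit, from which the contraction property follows. *)
From Stdlib Require Import Relation_Operators.
Require Import Defs.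
From mathcomp Require Import all_boot all_order all_algebra zify.
From mathcomp Require Import boolp classical_sets cardinality reals topology.

Set Implicit Arguments.
Unset Strict Implicit.
Unset Printing Implicit Defensive.

Import Order.TTheory GRing.Theory Num.Theory.
Local Open Scope classical_set_scope.
Local Open Scope group_scope.

(** * Integer powers and the Cayley metric *)

Section IntegerPowers.
Variable G : groupType.
Implicit Type x : G.

Lemma zexpgS x (n : int) : zexpg x (n + 1)%R = zexpg x n * x.
Proof.
case: n => [n|[|n]]; first by rewrite -PoszD addn1 /= expgSr.
  by rewrite NegzE addNr /= mulVg.
rewrite NegzE; have -> : (- (n.+2)%:Z + 1 = - (n.+1)%:Z)%R by lia.
by rewrite -!NegzE /= [x ^+ n.+2]expgS invgM mulgVK.
Qed.

Lemma zexpgD x (m n : int) : zexpg x (m + n)%R = zexpg x m * zexpg x n.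
Proof.
elim/int_ind: n => [|n IHn|n IHn].
- by rewrite addr0 mulg1.
- by rewrite -addn1 PoszD addrA !zexpgS IHn mulgA.
- apply: (mulIg x); rewrite -mulgA -!zexpgS.
  have -> : (m - n.+1%:Z + 1 = m - n%:Z)%R by lia.
  have -> : (- n.+1%:Z + 1 = - n%:Z)%R by lia.
  exact: IHn.
Qed.

Lemma zexpgN x (n : int) : zexpg x (- n)%R = (zexpg x n)^-1.
Proof. by apply: (mulIg (zexpg x n)); rewrite -zexpgD addNr mulVg. Qed.

Lemma zexpgX x N (n : int) : zexpg (x ^+ N) n = zexpg x (N%:Z * n)%R.
Proof.
case: n => n; first by rewrite -PoszM /= expgnA.
by rewrite NegzE mulrN -PoszM !zexpgN /= expgnA.
Qed.

Lemma zexpg_conj x y (n : int) : zexpg (x ^ y) n = zexpg x n ^ y.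
Proof. by case: n => n /=; rewrite ?conjVg conjXg. Qed.

End IntegerPowers.

Section CayleyDistance.
Variables (G : groupType) (S : set G) (genS : generates S).
Local Notation dist := (cayley_dist genS).

Lemma cayley_dist_sym x y : dist x y = dist y x.
Proof.
have le a b : (dist a b <= dist b a)%N.
  exact/cayley_dist_min/cayley_walk_sym/cayley_distP.
by apply/eqP; rewrite eqn_leq !le.
Qed.

Lemma cayley_dist_triangle y x z : (dist x z <= dist x y + dist y z)%N.
Proof. by apply/cayley_dist_min/cayley_walk_cat; exact: cayley_distP. Qed.

Lemma cayley_dist_mul g x y : dist (g * x) (g * y) = dist x y.
Proof.
have le h a b : (dist (h * a) (h * b) <= dist a b)%N.
  exact/cayley_dist_min/cayley_walk_mul/cayley_distP.
by apply/eqP; rewrite eqn_leq le -{1}[x](mulKg g) -{1}[y](mulKg g) le.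
Qed.

End CayleyDistance.

(** * Contraction from a sequence of bottlenecks *)

Section OrbitWithWalls.
Variables (G : groupType) (S : set G) (genS : generates S).
Local Notation dist := (cayley_dist genS).
Variables (g y : G) (N C : nat) (Q : int -> G -> Prop).
Definition orbit_point (n : int) : G := zexpg g n * y.
Local Notation o := orbit_point.
Local Open Scope ring_scope.
(* [Q k x] is to be read as: [x] is not strictly to the left of the wall [k]. *)
Hypotheses (N_gt0 : (0 < N)%N)
  (Q_anti : forall (k : int) x, Q (k + 1) x -> Q k x)
  (Q_step : forall (k : int) x x', Q (k + 1) x -> cayley_adj S x x' -> Q k x')
  (Q_neck : forall (k : int) x x', ~ Q k x -> Q (k + 1) x' ->
    (dist x (o (N%:Z * k)) + dist (o (N%:Z * k)) x' <= dist x x' + C)%N)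
  (Q_orbit : forall k : int, Q (k - 1) (o (N%:Z * k)))
  (nQ_orbit : forall k : int, ~ Q (k + 1) (o (N%:Z * k))).

Lemma orbit_dist (m n : int) : dist (o m) (o n) = dist (o 0) (o (n - m)).
Proof.
rewrite -(cayley_dist_mul genS (zexpg g (- m)%R)) /o !mulgA -!zexpgD.
by rewrite addNr addrC.
Qed.

Lemma Q_le (j k : int) x : j <= k -> Q k x -> Q j x.
Proof.
move=> jk; have -> : k = j + `|k - j|%N by lia.
elim: `|k - j|%N => [|m IHm]; first by rewrite addr0.
by rewrite -addn1 PoszD addrA => /Q_anti.
Qed.

Lemma Q_gt (j k : int) x : ~ Q k x -> Q j x -> j < k.
Proof. by move=> nQ Qj; rewrite ltNge; apply/negP => /Q_le/(_ Qj). Qed.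

Lemma Q_walk n (k : int) x x' : cayley_walk S n x x' -> Q (k + n%:Z) x -> Q k x'.
Proof.
elim: n x k => [|n IHn] x k /=; first by move=> ->; rewrite addr0.
case=> z xz wz; rewrite -addn1 PoszD addrA => /Q_step/(_ xz); exact: IHn.
Qed.

(** By [Q_step], one edge lowers the last wall passed by at most one, so levels are coarsely
    Lipschitz. *)
Lemma Q_dist (k : int) x x' n : (dist x x' <= n)%N -> Q (k + n%:Z) x -> Q k x'.
Proof.
move=> dn h; apply: (Q_walk (cayley_distP genS x x')); apply: Q_le h; lia.
Qed.

Lemma level_exists x : exists k : int, Q k x /\ ~ Q (k + 1) x.
Proof.
pose n := dist (o 0) x.
have lo : Q (- 1 - n%:Z) x.
  apply: (@Q_dist _ (o 0) _ n) => //.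
  by have := Q_orbit 0; rewrite mulr0; apply: Q_le; lia.
have hi : ~ Q (1 + n%:Z) x.
  move=> /(@Q_dist 1 x (o 0) n); rewrite cayley_dist_sym leqnn => /(_ isT).
  by have := @nQ_orbit 0; rewrite mulr0 add0r.
have {lo hi} : exists j m, Q j x /\ ~ Q (j + m%:Z) x.
  exists (- 1 - n%:Z), (n + n + 2)%N; split=> //.
  by have -> : - 1 - n%:Z + (n + n + 2)%N%:Z = 1 + n%:Z by lia.
case=> j [m]; elim: m j => [|m IHm] j [Qj nQj]; first by rewrite addr0 in nQj.
have [Qj1|nQj1] := EM (Q (j + 1) x); last by exists j.
apply: (IHm (j + 1)); split=> //.
by have -> : j + 1 + m%:Z = j + m.+1%:Z by lia.
Qed.

Let delta := dist (o 0) (o N).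
Let eps := (\max_(r < N) dist (o 0) (o r))%N.

Lemma orbit_dist_mul (s k : int) j :
  (dist (o (s * k)) (o (s * (k + j%:Z))) <= j * dist (o 0) (o s))%N.
Proof.
elim: j => [|j IHj].
  by rewrite addr0 orbit_dist subrr; apply: cayley_dist_min.
apply: leq_trans (cayley_dist_triangle _ (o (s * (k + j%:Z))) _ _) _.
rewrite mulSn addnC leq_add //.
rewrite orbit_dist; suff -> : s * (k + j.+1%:Z) - s * (k + j%:Z) = s by [].
by rewrite -mulrBr (_ : _ - _ = 1) ?mulr1 //; lia.
Qed.

Lemma orbit_dist_le (s k l : int) j : `|k - l| <= j%:Z ->
  (dist (o (s * k)) (o (s * l)) <= j * dist (o 0) (o s))%N.
Proof.
move=> klj; wlog kl : k l klj / k <= l.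
  move=> h; have [kl|/ltW lk] := leP k l; first exact: h.
  by rewrite cayley_dist_sym; apply: h; rewrite // distrC.
have -> : l = k + `|l - k|%N by lia.
by apply: leq_trans (orbit_dist_mul _ _ _) _; rewrite leq_mul2r; lia.
Qed.

Lemma orbit_near (n : int) : exists (i : int) (r : 'I_N), n = N%:Z * i + r%:Z /\
  (dist (o (N%:Z * i)) (o n) <= eps)%N.
Proof.
have N0 : N%:Z != 0 by rewrite -lt0n.
have r0 := modz_ge0 n N0; have rN : (n %% N)%Z < N%:Z by exact: ltz_pmod.
have rN' : (`|(n %% N)%Z| < N)%N by lia.
exists (n %/ N)%Z, (Ordinal rN').
have nE : n = N%:Z * (n %/ N)%Z + `|(n %% N)%Z|%N.
  by rewrite {1}(divz_eq n N) mulrC; congr (_ + _); lia.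
split=> //; rewrite orbit_dist {1}nE addrAC subrr add0r.
exact: (leq_bigmax (F := fun r : 'I_N => dist (o 0) (o r)) (Ordinal rN')).
Qed.

(** By [Q_dist], a short distance bounds the number of walls between two orbit points, and
    consecutive walls are [N] powers of [g] apart. The remainder modulo [N] costs [eps]. *)
Lemma orbit_qi (m n : int) : (`|n - m| <= N * (dist (o m) (o n) + eps + 2))%N.
Proof.
rewrite orbit_dist; wlog nm : m n / 0 <= n - m.
  move=> h; have [nm|/ltW mn] := leP 0 (n - m); first exact: h.
  have := h n m; rewrite -(orbit_dist n m) cayley_dist_sym orbit_dist => h'.
  by rewrite distnC; apply: h'; lia.
set t := n - m in nm *; have [i [r [tE di]]] := orbit_near t.
set d := dist (o 0) (o t).
have db : (dist (o (N%:Z * i)) (o 0) <= eps + d)%N.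
  apply: leq_trans (cayley_dist_triangle _ (o t) _ _) _.
  by rewrite leq_add // cayley_dist_sym.
have : Q (i - 1 - (eps + d)%N%:Z) (o 0).
  by apply: Q_dist db _; rewrite subrK.
have := @nQ_orbit 0; rewrite mulr0 add0r => nQ /(Q_gt nQ) ib.
have rN := ltn_ord r.
have : (t <= N%:Z * (i + 1)) by rewrite tE mulrDr mulr1 lerD2l; lia.
have ib' : i + 1 <= (d + eps + 2)%N%:Z by lia.
have : N%:Z * (i + 1) <= N%:Z * (d + eps + 2)%N%:Z by rewrite ler_wpM2l.
by rewrite -PoszM; lia.
Qed.

Let C1 := (C + delta + eps + (eps + 2) * delta)%N.

Definition nearest x (n : int) := forall m, (dist x (o n) <= dist x (o m))%N.

(** If the levels of [x] and [o n] differ by at least two, a bottleneck separates them next to level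
    [k]; as [o n] is no farther from [x] than this bottleneck, it lies within [C] of it. Otherwise
    the level of [o n] determines [n] up to a bounded error. *)
Lemma nearest_level x n (k : int) : nearest x n -> Q k x -> ~ Q (k + 1) x ->
  (dist (o n) (o (N%:Z * k)) <= C1)%N.
Proof.
move=> xn Qk nQk; have [j [Qj nQj]] := level_exists (o n).
have near i : `|i - k| <= 1 -> (dist (o (N%:Z * i)) (o n) <= C)%N ->
    (dist (o n) (o (N%:Z * k)) <= C1)%N.
  move=> ik di; apply: leq_trans (cayley_dist_triangle _ (o (N%:Z * i)) _ _) _.
  rewrite (cayley_dist_sym _ (o n)) /C1 -!addnA leq_add //.
  by have := @orbit_dist_le N i k 1 ik; rewrite mul1n -/delta; lia.
have [jk|jk] := leP (k + 2) j.
  have Q2 : Q (k + 1 + 1) (o n) by apply: Q_le Qj; lia.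
  have := Q_neck nQk Q2; have := xn (N%:Z * (k + 1)) => d1 d2.
  by apply: (near (k + 1)); lia.
have [kj|kj] := leP (j + 2) k.
  have nQ1 : ~ Q (k - 1) (o n) by move=> h; apply: nQj; apply: Q_le h; lia.
  have Q1 : Q (k - 1 + 1) x by rewrite subrK.
  have := Q_neck nQ1 Q1; have := xn (N%:Z * (k - 1)); set p := o (N%:Z * _).
  move=> d1 d2; rewrite (cayley_dist_sym _ p) !(cayley_dist_sym _ (o n)) in d2.
  by apply: (near (k - 1)); rewrite -/p; lia.
have [i [r [_ di]]] := orbit_near n.
have : i - 1 - eps%:Z < j + 1.
  by apply: Q_gt nQj _; apply: Q_dist di _; rewrite subrK.
have : j - eps%:Z < i + 1.
  apply: Q_gt (nQ_orbit (k := i)) _; rewrite cayley_dist_sym in di.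
  by apply: Q_dist di _; rewrite subrK.
move=> b1 b2; have ik : `|i - k| <= (eps + 2)%N%:Z by lia.
apply: leq_trans (cayley_dist_triangle _ (o (N%:Z * i)) _ _) _.
have := @orbit_dist_le N _ _ _ ik; rewrite -/delta; rewrite (cayley_dist_sym _ (o n)) /C1; lia.
Qed.

Let C2 := (C + C + delta + C1)%N.

(** If the levels of [x] and [x'] differ by at least two, some bottleneck on the orbit lies almost
    between them; since [x'] is closer to [x] than that point, it is within [C] of it. Otherwise
    [nearest_level] applies to [x']. *)
Lemma ball_projection x x' n (k : int) : Q k x -> ~ Q (k + 1) x ->
  (forall m, (dist x x' < dist x (o m))%N) -> nearest x' n ->
  (dist (o n) (o (N%:Z * k)) <= C2)%N.
Proof.
move=> Qk nQk far x'n; have [j [Qj nQj]] := level_exists x'.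
have near i : `|i - k| <= 1 -> (dist x' (o (N%:Z * i)) <= C)%N ->
    (dist (o n) (o (N%:Z * k)) <= C2)%N.
  move=> ik di; apply: leq_trans (cayley_dist_triangle _ (o (N%:Z * i)) _ _) _.
  have := cayley_dist_triangle genS x' (o n) (o (N%:Z * i)).
  have := x'n (N%:Z * i); rewrite (cayley_dist_sym _ (o n) x').
  have := @orbit_dist_le N i k 1 ik; rewrite mul1n -/delta /C2; lia.
have [jk|jk] := leP (k + 2) j.
  have Q2 : Q (k + 1 + 1) x' by apply: Q_le Qj; lia.
  have := Q_neck nQk Q2; have := far (N%:Z * (k + 1)); set p := o (N%:Z * _).
  rewrite (cayley_dist_sym _ p x') => d1 d2.
  by apply: (near (k + 1)); rewrite -/p; lia.
have [kj|kj] := leP (j + 2) k.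
  have nQ1 : ~ Q (k - 1) x' by move=> h; apply: nQj; apply: Q_le h; lia.
  have Q1 : Q (k - 1 + 1) x by rewrite subrK.
  have := Q_neck nQ1 Q1; have := far (N%:Z * (k - 1)); set p := o (N%:Z * _).
  rewrite (cayley_dist_sym _ p x) (cayley_dist_sym _ x' x) => d1 d2.
  by apply: (near (k - 1)); rewrite -/p; lia.
have := nearest_level x'n Qj nQj.
have := cayley_dist_triangle genS (o (N%:Z * j)) (o n) (o (N%:Z * k)).
have : `|j - k| <= 1 by lia.
by move=> /(@orbit_dist_le N j k 1); rewrite mul1n -/delta /C2; lia.
Qed.

Lemma walls_contracting (R : realType) : contracting (cayley_action R genS) g.
Proof.
exists (y : cayley R genS) => orb.
have dE m n : mdist (orb m) (orb n) = (dist (o m) (o n))%:R :> R by [].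
split.
  (* One multiplicative constant serves both bounds: [N] for the lower one, the length of one orbit
     step for the upper one, and the last [1] for [1 <= A]. *)
  exists (N + dist (o 0) (o 1) + 1)%:R, (eps + 2)%:R; split=> //.
    by rewrite natrD lerDr.
  move=> m n; rewrite dE (_ : `|m - n|%:~R = `|m - n|%N%:R); last first.
    by rewrite -abszE.
  apply/andP; split.
    rewrite lerBlDr ler_pdivrMl ?ltr0n ?addn1 // -natrD -natrM ler_nat.
    have := orbit_qi n m; rewrite (cayley_dist_sym _ (o n)) addnA => h.
    apply: leq_trans h _; rewrite -addnA leq_mul2r; lia.
  rewrite -natrM -natrD ler_nat.
  have := @orbit_dist_le 1 m n `|m - n|%N; rewrite !mul1r => h.
  by apply: leq_trans (h _) _; rewrite ?abszE //; nia.
exists (C2 + C2)%:R => // x r disj.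
have [k [Qk nQk]] := level_exists x.
have close p : projection (range orb) (ball x r) p ->
    exists2 n, p = orb n & (dist (o n) (o (N%:Z * k)) <= C2)%N.
  case=> [[n _ <-] [x' xx' near]]; exists n => //.
  apply: (@ball_projection x x') => // m.
    rewrite -(ltr_nat R); have : ~ ball x r (orb m).
      by move=> xm; rewrite -[False]/(set0 (orb m)) -disj; split=> //; exists m.
    move: xx'; rewrite !ballEmdist /= => xx' /negP; rewrite -leNgt.
    exact: lt_le_trans.
  by rewrite -(ler_nat R); apply: (near (orb m)); exists m.
move=> p q /close[m -> dm] /close[n -> dn]; rewrite dE ler_nat.
apply: leq_trans (cayley_dist_triangle _ (o (N%:Z * k)) _ _) _.
by rewrite leq_add // cayley_dist_sym.
Qed.

End OrbitWithWalls.

(** * Normal forms in graph products *)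

Section NormalForm.
Variables (V : finType) (e : rel V).
Hypotheses (e_sym : symmetric e) (e_irr : irreflexive e).
Variable G : V -> groupType.

Local Notation syll := (syllable G).
Local Notation word := (Defs.word G).
Local Notation ev := (Defs.eval e (G:=G)).
Local Notation gp := (graph_product e G).

Definition coef (v : V) (s : syll) : G v :=
  if tag s =P v is ReflectT p then eq_rect _ G (tagged s) _ p else 1.

Lemma coefE v (a : G v) : coef v (syl a) = a.
Proof. by rewrite /coef /=; case: eqP => // p; rewrite (eq_axiomK p). Qed.

Definition mark (v : V) (s : syll) : option syll :=
  if tag s == v then Some s else None.

(* Words are compared through their stacks: at each vertex [v], record the
   [v]-syllables, and a blank [None] for each syllable not commuting with [G v].
   Stacks are invariant under exchanges and determine the reduced word up to
   exchanges. *)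
Definition stack (v : V) (w : word) : seq (option syll) :=
  [seq mark v s | s <- w & ~~ e v (tag s)].

Lemma stack_cat v w w' : stack v (w ++ w') = stack v w ++ stack v w'.
Proof. by rewrite /stack filter_cat map_cat. Qed.

Definition top (l : seq (option syll)) : bool :=
  if l is Some _ :: _ then true else false.

Definition topcoef (v : V) (l : seq (option syll)) : G v :=
  if l is Some s :: _ then coef v s else 1.

Definition state := V -> seq (option syll).

Definition stacks (w : word) : state := stack^~ w.

Definition push (s : syll) (P : state) : state := fun t =>
  if e t (tag s) then P t else mark t s :: P t.

Definition pop (v : V) (P : state) : state := fun t =>
  if e t v then P t else behead (P t).

(** The trivial syllable is not stored; thus, over a state [P] with no [v]-syllable on top,
    [pushc c P] is uniform in [c] and the law of [G v] becomes [add_pushc]. *)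
Definition pushc (v : V) (c : G v) (P : state) : state :=
  if c == 1 then P else push (syl c) P.

Definition poptop (v : V) (P : state) : state :=
  if topcoef v (P v) == 1 then P else pop v P.

(* Left multiplication by [s], on the stacks of a reduced word. *)
Definition add (s : syll) (P : state) : state :=
  pushc (tagged s * topcoef (tag s) (P (tag s))) (poptop (tag s) P).

Lemma stacks_cons s w : stacks (s :: w) = push s (stacks w).
Proof. by apply/funext => t; rewrite /stacks /push /stack /=; case: (e t _). Qed.

Lemma stack_consl v (c : G v) w : stack v (syl c :: w) = Some (syl c) :: stack v w.
Proof. by rewrite /stack /= e_irr /= /mark /= eqxx. Qed.

Lemma stack_adj v s w : e v (tag s) -> stack v (s :: w) = stack v w.
Proof. by rewrite /stack /= => -> /=. Qed.

Lemma stack_nadj v s w : ~~ e v (tag s) -> tag s != v ->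
  stack v (s :: w) = None :: stack v w.
Proof. by rewrite /stack /= => -> /=; rewrite /mark => /negPf ->. Qed.

Lemma popK s P : pop (tag s) (push s P) = P.
Proof. by apply/funext => t; rewrite /pop /push; case: (e t _). Qed.

Lemma push_comm s s' P : e (tag s) (tag s') ->
  push s (push s' P) = push s' (push s P).
Proof.
move=> ss'; apply/funext => t; rewrite /push /mark.
have [ts|ts] := boolP (e t (tag s)); have [ts'|ts'] := boolP (e t (tag s')) => //.
case: eqP => [st|_]; first by rewrite -st ss' in ts'.
by case: eqP => [st|_] //; rewrite -st e_sym ss' in ts.
Qed.

Lemma pushc_comm u v (a : G u) (b : G v) P : e u v ->
  pushc a (pushc b P) = pushc b (pushc a P).
Proof.
by rewrite /pushc => uv; do 2!case: ifP => // _; rewrite push_comm.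
Qed.

Lemma topcoef_pushc v (c : G v) P :
  topcoef v (P v) = 1 -> topcoef v (pushc c P v) = c.
Proof.
rewrite /pushc; case: eqP => [-> //|_ _].
by rewrite /push /= e_irr /mark eqxx /= coefE.
Qed.

Lemma poptop_pushc v (c : G v) P :
  topcoef v (P v) = 1 -> poptop v (pushc c P) = P.
Proof.
move=> P1; rewrite /poptop topcoef_pushc //; case: eqP => [->|c1].
  by rewrite /pushc eqxx.
by rewrite /pushc; case: eqP => // _; rewrite -[v]/(tag (syl c)) popK.
Qed.

Lemma add_pushc v (b c : G v) P :
  topcoef v (P v) = 1 -> add (syl b) (pushc c P) = pushc (b * c) P.
Proof. by move=> P1; rewrite /add /= topcoef_pushc // poptop_pushc. Qed.

Lemma pushc_adj u v (b : G v) P : e u v -> pushc b P u = P u.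
Proof. by rewrite /pushc; case: ifP => // _; rewrite /push /= => ->. Qed.

Definition nn (x y : option syll) := ~~ (isSome x && isSome y).

(** Two consecutive non-blank entries of [stack v] are two [v]-syllables that exchanges can bring
    together; [nn] forbids exactly this. *)
Definition reduced (w : word) : Prop :=
  all (fun s : syll => (tagged s : G (tag s)) != 1) w /\ forall v, sorted nn (stack v w).

Lemma nn_sorted_cat l l' : sorted nn (l ++ l') =
  [&& sorted nn l, sorted nn l' & ~~ (top (rev l) && top l')].
Proof.
case: (lastP l) => [|{}l x] /=; first by rewrite andbT.
case: l' => [|y l'] /=; first by rewrite cats0 andbF andbT.
rewrite sorted_cat_cons rev_rcons -[rcons (rcons _ _) _]cats1 cat_rcons.
rewrite sorted_cat_cons /= andbT -andbA; congr andb.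
by rewrite andbC /nn; congr andb; case: x y => [?|] [?|].
Qed.

Lemma red_cons s w :
  reduced (s :: w) <-> [/\ (tagged s : G (tag s)) != 1, ~~ top (stack (tag s) w) & reduced w].
Proof.
case: s => v b; rewrite -/(syl b); split=> [[/= /andP[b1 aw] sw]|/= [b1 tw [aw sw]]].
  split=> //; first by move: (sw v); rewrite stack_consl /=; case: stack => [|[?|]?].
  split=> // u; move: (sw u); rewrite -[_ :: w]cat1s stack_cat nn_sorted_cat.
  by case/and3P.
split=> [|u]; first by rewrite /= b1.
rewrite -[_ :: w]cat1s stack_cat nn_sorted_cat sw andTb.
case: (boolP (e u v)) => uv; first by rewrite stack_adj.
have [<-{u uv}|vu] := eqVneq v u; last by rewrite stack_nadj // eq_sym.
by rewrite stack_consl /=.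
Qed.

Lemma stack_top v w s r : stack v w = Some s :: r ->
  exists m t, [/\ w = m ++ s :: t, all (fun x : syll => e v (tag x)) m, tag s = v
    & stack v t = r].
Proof.
elim: w => [//|x w IHw]; rewrite /stack /=.
case: ifP => /= [vx|/negbFE vx].
  rewrite /mark; case: eqP => // xv [<- <-].
  by exists [::], w.
by case/IHw => m [t [-> am ts tr]]; exists (x :: m), t; rewrite /= vx.
Qed.

Lemma red_topcoef v w : reduced w ->
  (topcoef v (stack v w) == 1) = ~~ top (stack v w).
Proof.
case=> aw _; case E : (stack v w) => [|[s|] r] //=; rewrite ?eqxx //.
have [m [t [wE _ sv _]]] := stack_top E.
move: aw; rewrite wE all_cat /= => /and3P[_ s1 _]; apply/negbTE.
by case: s sv s1 {E wE} => u a /= uv; subst u; rewrite -/(syl a) coefE.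
Qed.

(** The first [v]-syllable is shuffled to the front past adjacent vertices; if something blocks it,
    [c = 1]. The equality of stacks reduces later computations to [pushc]. *)
Lemma red_split v w : reduced w -> exists (c : G v) w',
  [/\ reduced w', topcoef v (stack v w') = 1, stacks w = pushc c (stacks w'),
      ev w = incl e c * ev w' & {subset map tag w' <= map tag w}].
Proof.
elim: w => [|[u b] w IHw] rw.
  by exists 1, [::]; rewrite /pushc eqxx incl1 mul1g.
have := rw; rewrite red_cons /= => -[b1 tu rw1].
have [uv|uv] := eqVneq u v.
  subst u; exists b, w; split=> //.
  - by apply/eqP; rewrite red_topcoef.
  - by rewrite stacks_cons /pushc (negPf b1).
  - by rewrite eval_cons.
  - by move=> x; rewrite inE => ->; rewrite orbT.
have [vu|vu] := boolP (e v u); last first.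
  exists 1, (existT _ u b :: w); split; rewrite ?incl1 ?mul1g //.
    by rewrite stack_nadj.
  by rewrite /pushc eqxx.
have [c [w' [rw' tv sE ew sub]]] := IHw rw1.
have uv' : e u v by rewrite e_sym.
exists c, (syl b :: w'); split.
- rewrite red_cons /=; split=> //.
  by move: tu; rewrite -/(stacks w u) sE pushc_adj.
- by rewrite stack_adj.
- rewrite stacks_cons sE stacks_cons /pushc; case: ifP => // _.
  by rewrite push_comm.
- by rewrite !eval_cons ew !mulgA; congr (_ * _); exact: incl_commute.
- move=> x; rewrite !inE /= => /orP[->//|/sub ->]; exact: orbT.
Qed.

Definition valid (P : state) : Prop := exists2 w, reduced w & P = stacks w.

Lemma valid_split v P : valid P -> exists (c : G v) P',
  [/\ valid P', topcoef v (P' v) = 1 & P = pushc c P'].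
Proof.
case=> w rw ->; have [c [w' [rw' t1 -> _ _]]] := red_split v rw.
by exists c, (stacks w'); split=> //; exists w'.
Qed.

Lemma valid_pushc v (c : G v) P :
  valid P -> topcoef v (P v) = 1 -> valid (pushc c P).
Proof.
move=> [w rw ->] t1; rewrite /pushc; case: eqP => [_|/eqP c1]; first by exists w.
exists (syl c :: w); last by rewrite stacks_cons.
by rewrite red_cons; split=> //=; rewrite -red_topcoef //; apply/eqP.
Qed.

Lemma valid_add s P : valid P -> valid (add s P).
Proof.
case: s => v b /(valid_split v)[c [P' [vP' t1 ->]]].
by rewrite -/(syl b) add_pushc //; apply: valid_pushc.
Qed.

Lemma add1 v P : valid P -> add (syl (1 : G v)) P = P.
Proof.
by move=> /(valid_split v)[c [P' [_ t1 ->]]]; rewrite add_pushc // mul1g.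
Qed.

Lemma addM v (a b : G v) P :
  valid P -> add (syl a) (add (syl b) P) = add (syl (a * b)) P.
Proof.
by move=> /(valid_split v)[c [P' [_ t1 ->]]]; rewrite !add_pushc // mulgA.
Qed.

Lemma add_comm u v (a : G u) (b : G v) P : e u v ->
  valid P -> add (syl a) (add (syl b) P) = add (syl b) (add (syl a) P).
Proof.
move=> uv; have vu : e v u by rewrite e_sym.
move=> /(valid_split v)[c [P1 [vP1 t1 ->]]].
have [d [P2 [_ t2 P1E]]] := valid_split u vP1.
have t3 : topcoef v (P2 v) = 1 by move: t1; rewrite P1E pushc_adj.
have swap (x : G u) (y : G v) : pushc y (pushc x P2) = pushc x (pushc y P2).
  exact: pushc_comm.
rewrite P1E add_pushc ?pushc_adj // swap add_pushc ?pushc_adj //.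
by rewrite swap add_pushc ?pushc_adj // -!swap add_pushc ?pushc_adj.
Qed.

Definition nfw (w : word) : state := foldr add (fun=> [::]) w.

Lemma valid_nfw w : valid (nfw w).
Proof.
elim: w => [|s w IHw] /=; last exact: valid_add.
by exists [::] => //; split.
Qed.

(** Van der Waerden's argument: the vertex groups act on valid states through [add], and the three
    kinds of moves are the relations checked by [add1], [addM] and [add_comm]. *)
Lemma nfw_emove w w' : emove e w w' -> nfw w = nfw w'.
Proof.
rewrite /nfw; case=> [s t u|s t u a b|s t u v a b uv]; rewrite !foldr_cat /=;
  congr (foldr _ _ s).
- exact/add1/valid_nfw.
- exact/addM/valid_nfw.
- exact: add_comm (valid_nfw t).
Qed.

Lemma nfw_eq w w' : ev w = ev w' -> nfw w = nfw w'.
Proof.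
move/evalP; elim=> [x y|x|x y _ ->|x y z _ -> _ ->] //; exact: nfw_emove.
Qed.

Definition nf (x : gp) : state := nfw (repr x).

Lemma nf_ev w : nf (ev w) = nfw w.
Proof. by apply: nfw_eq; rewrite /Defs.eval generic_quotient.reprK. Qed.

Lemma nf_incl v (a : G v) x : nf (incl e a * x) = add (syl a) (nf x).
Proof. by have [w ->] := eval_surj x; rewrite -eval_cons !nf_ev. Qed.

Lemma valid_nf x : valid (nf x). Proof. exact: valid_nfw. Qed.

Lemma nf_red w : reduced w -> nf (ev w) = stacks w.
Proof.
rewrite nf_ev; elim: w => [//|[v a] w IHw]; rewrite red_cons /= => -[a1 tw rw].
rewrite IHw // stacks_cons; have t1 : topcoef v (stack v w) = 1.
  by apply/eqP; rewrite red_topcoef.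
have -> : stacks w = pushc (1 : G v) (stacks w) by rewrite /pushc eqxx.
by rewrite -/(syl a) add_pushc // mulg1 /pushc (negPf a1) eqxx.
Qed.

Definition hd (v : V) (x : gp) : G v := topcoef v (nf x v).

Lemma hd_red v w : reduced w -> hd v (ev w) = topcoef v (stack v w).
Proof. by move=> rw; rewrite /hd nf_red. Qed.

Lemma hd_eq1 v w : reduced w -> (hd v (ev w) == 1) = ~~ top (stack v w).
Proof. by move=> rw; rewrite hd_red // red_topcoef. Qed.

Lemma hd1 v : hd v 1 = 1.
Proof. by rewrite -(eval0 e G) hd_red //; split. Qed.

Lemma hd_same v (a : G v) x : hd v (incl e a * x) = a * hd v x.
Proof.
rewrite /hd nf_incl; have [c [P [_ t1 ->]]] := valid_split v (valid_nf x).
by rewrite add_pushc // !topcoef_pushc.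
Qed.

Lemma hd_adj u v (a : G u) x : e u v -> hd v (incl e a * x) = hd v x.
Proof.
rewrite e_sym /hd nf_incl => vu.
have [c [P [_ t1 ->]]] := valid_split u (valid_nf x).
by rewrite add_pushc // !pushc_adj.
Qed.

(** The product has a non-trivial [u]-syllable in front, which blocks every [v]-syllable. *)
Lemma hd_nadj u v (a : G u) x : u != v -> ~~ e u v -> a * hd u x != 1 ->
  hd v (incl e a * x) = 1.
Proof.
rewrite e_sym /hd nf_incl => uv vu.
have [c [P [_ t1 ->]]] := valid_split u (valid_nf x).
rewrite add_pushc // topcoef_pushc // /pushc => /negPf ->.
by rewrite /push /= (negPf vu) /mark /= (negPf uv).
Qed.

Lemma red_exists w : exists w',
  [/\ reduced w', ev w' = ev w & {subset map tag w' <= map tag w}].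
Proof.
elim: w => [|[v a] w [w1 [rw1 e1 s1]]]; first by exists [::]; split=> //; split.
have [c [w2 [rw2 t1 _ e2 s2]]] := red_split v rw1.
have eE : ev (existT _ v a :: w) = incl e (a * c) * ev w2.
  by rewrite eval_cons -e1 e2 mulgA inclM.
have sub : {subset map tag w2 <= map tag (existT (fun u => G u : Type) v a :: w)}.
  by move=> x /s2 /s1 h; rewrite inE h orbT.
case: (eqVneq (a * c) 1) => [ac|ac].
  by exists w2; split=> //; rewrite eE ac incl1 mul1g.
exists (syl (a * c) :: w2); split; last 2 first.
- by rewrite eval_cons.
- by move=> x; rewrite inE => /orP[/eqP ->|/sub //]; exact: mem_head.
by rewrite red_cons; split=> //=; rewrite -red_topcoef //; apply/eqP.
Qed.

Lemma red_repr x : exists2 w, reduced w & x = ev w.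
Proof.
have [w ->] := eval_surj x; have [w' [rw' <- _]] := red_exists w.
by exists w'.
Qed.

(** * Elements supported on a set of vertices *)

Definition over (L : {set V}) (w : word) := all (fun s : syll => tag s \in L) w.

Definition supported (L : {set V}) (x : gp) : Prop := exists2 w, over L w & ev w = x.

Lemma supported_red L x : supported L x -> exists w, [/\ reduced w, over L w & ev w = x].
Proof.
case=> w oL <-; have [w' [rw' ew' sub]] := red_exists w.
exists w'; split=> //; apply/allP => s sw'.
have /sub/mapP[s' s'w ->] : tag s \in map tag w' by apply: map_f.
exact: (allP oL).
Qed.

Lemma over_cat L w w' : over L (w ++ w') = over L w && over L w'.
Proof. exact: all_cat. Qed.

Lemma over_sub (L L' : {set V}) w : L \subset L' -> over L w -> over L' w.
Proof. by move=> /fintype.subsetP LL' /allP wL; apply/allP => s /wL /LL'. Qed.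

Lemma supported1 L : supported L 1.
Proof. by exists [::]. Qed.

Lemma supportedM L x y : supported L x -> supported L y -> supported L (x * y).
Proof.
move=> [w wL <-] [w' wL' <-]; exists (w ++ w'); last exact: evalM.
by rewrite over_cat wL.
Qed.

Lemma supported_incl (L : {set V}) v (a : G v) : v \in L -> supported L (incl e a).
Proof. by move=> vL; exists [:: syl a]; rewrite //= vL. Qed.

Lemma ev_word_inv w : ev (word_inv w) = (ev w)^-1.
Proof. by apply: (mulIg (ev w)); rewrite -evalM eval_invl mulVg. Qed.

Lemma over_word_inv L w : over L (word_inv w) = over L w.
Proof. by rewrite /over /word_inv all_rev all_map; apply: eq_all => -[]. Qed.

Lemma supportedV L x : supported L x -> supported L x^-1.
Proof.
by move=> [w wL <-]; exists (word_inv w); rewrite ?over_word_inv ?ev_word_inv.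
Qed.

Lemma supported_sub (L L' : {set V}) x : L \subset L' -> supported L x -> supported L' x.
Proof. by move=> LL' [w /(over_sub LL') wL <-]; exists w. Qed.

Definition link (v : V) : {set V} := [set u | e v u].

Lemma supported_link_commute v (a : G v) x : supported (link v) x ->
  commute (incl e a) x.
Proof.
case=> w; elim: w x => [|[u b] w IHw] x; first by move=> _ <-; exact: commute1.
rewrite /over /= inE => /andP[vu wL] <-; rewrite eval_cons.
by apply: commuteM; [exact: incl_commute|apply: IHw].
Qed.

Lemma hd_supported (L : {set V}) v x : v \notin L -> supported L x -> hd v x = 1.
Proof.
move=> vL /supported_red[w [rw wL <-]]; apply/eqP; rewrite hd_eq1 //.
case E : stack => [|[s|]r] //; have [m [t [wE _ sv _]]] := stack_top E.
by move: wL; rewrite wE over_cat /= sv (negPf vL) andbF.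
Qed.

(* [hd t] separates the sectors of the hyperplane with carrier [<star t>]: an
   edge of the Cayley graph on which it changes lies in that carrier. *)
Lemma hd_mulr t v (s : G v) x : hd t (x * incl e s) <> hd t x ->
  t = v /\ supported (link v) ((incl e (hd t x))^-1 * x).
Proof.
have [w rw ->] := red_repr x; elim: w t rw => [|[u b] w IHw] t.
  rewrite eval0 mul1g hd1 incl1 mulg1 invg1 => _.
  have [<-|vt] := eqVneq v t; first by split=> //; exact: supported1.
  case; apply: (hd_supported (L := [set v])); first by rewrite inE eq_sym.
  by apply: supported_incl; rewrite inE.
rewrite red_cons /= -/(syl b) => -[b1 tu rw]; rewrite eval_cons -mulgA.
have [ut|ut] := eqVneq u t.
  subst u; rewrite !hd_same => hh.
  have [h|tv pl] := IHw t rw; first by apply: hh; rewrite h.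
  by split=> //; rewrite inclM invgM -mulgA mulKg.
have [aut|naut] := boolP (e u t).
  rewrite !hd_adj // => /(IHw t rw)[tv pl]; split=> //.
  rewrite mulgA -inclV (incl_commute _ _ (_ : e t u)) ?inclV; last by rewrite e_sym.
  rewrite -mulgA; apply: supportedM => //; apply: supported_incl.
  by rewrite inE -tv e_sym.
have hu1 : hd u (ev w) = 1 by apply/eqP; rewrite hd_eq1.
rewrite (hd_nadj _ naut) ?hu1 ?mulg1 //.
(* The front syllable [b] still blocks [t] unless [s] cancels it. In that case [s = b^-1] commutes
   with [ev w] and the product is [ev w], which has no [t]-syllable because [t] is not adjacent to
   [u]. *)
have [bh|bh] := eqVneq (b * hd u (ev w * incl e s)) 1; last first.
  by rewrite hd_nadj.
have hh : hd u (ev w * incl e s) <> hd u (ev w).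
  by rewrite hu1 => h; move: bh b1; rewrite h mulg1 => ->; rewrite eqxx.
have [uv] := IHw u rw hh; subst v; rewrite hu1 incl1 invg1 mul1g => pw.
have := supported_link_commute s pw => cs.
have sE : s = b^-1.
  move: bh; rewrite -cs hd_same hu1 mulg1 => bs.
  by apply: (mulgI b); rewrite bs mulgV.
rewrite -cs mulgA -inclM sE mulgV incl1 mul1g => h1; case: h1.
by apply: (hd_supported _ pw); rewrite inE.
Qed.

(* [emit L w] collects the syllables of [w] that can be shuffled to the front
   inside [<L>], [residue L w] the other ones, and [shrink L w] is the set of
   vertices of [L] whose syllables, appended to [w], would still be emitted. *)
Fixpoint emit (L : {set V}) (w : word) : word :=
  if w is s :: w' then
    if tag s \in L then s :: emit L w' else emit (L :&: link (tag s)) w'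
  else [::].

Fixpoint residue (L : {set V}) (w : word) : word :=
  if w is s :: w' then
    if tag s \in L then residue L w' else s :: residue (L :&: link (tag s)) w'
  else [::].

Fixpoint shrink (L : {set V}) (w : word) : {set V} :=
  if w is s :: w' then
    if tag s \in L then shrink L w' else shrink (L :&: link (tag s)) w'
  else L.

Lemma shrink_sub L w : shrink L w \subset L.
Proof.
elim: w L => [|s w IHw] L //=; case: ifP => // _.
exact: fintype.subset_trans (IHw _) (subsetIl _ _).
Qed.

Lemma emit_cat L w w' : emit L (w ++ w') = emit L w ++ emit (shrink L w) w'.
Proof. by elim: w L => [|s w IHw] L //=; case: ifP => //= _; rewrite IHw. Qed.

Lemma residue_cat L w w' : residue L (w ++ w') = residue L w ++ residue (shrink L w) w'.
Proof. by elim: w L => [|s w IHw] L //=; case: ifP => //= _; rewrite IHw. Qed.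

Lemma shrink_cat L w w' : shrink L (w ++ w') = shrink (shrink L w) w'.
Proof. by elim: w L => [|s w IHw] L //=; case: ifP => //= _; rewrite IHw. Qed.

Lemma emit_over L w : over L (emit L w).
Proof.
elim: w L => [|s w IHw] L //=; case: ifP => /= [->|_]; first exact: IHw.
exact: over_sub (subsetIl _ _) (IHw _).
Qed.

(** Each skipped syllable cuts [L] down to the link of its vertex, so everything emitted later
    commutes with it. *)
Lemma emit_residue L w : ev w = ev (emit L w) * ev (residue L w).
Proof.
elim: w L => [|[v a] w IHw] L /=; first by rewrite mul1g.
rewrite -/(syl a); case: ifP => _; rewrite !eval_cons.
  by rewrite (IHw L) mulgA.
have c : commute (incl e a) (ev (emit (L :&: link v) w)).
  apply: supported_link_commute; exists (emit (L :&: link v) w) => //.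
  exact: over_sub (subsetIr _ _) (emit_over _ _).
by rewrite (IHw (L :&: link v)) !mulgA c.
Qed.

Lemma stack_residue (L : {set V}) v w : L \subset link v ->
  stack v (residue L w) = stack v w.
Proof.
elim: w L => [|s w IHw] L Lv //=; case: ifP => sL.
  rewrite IHw // [RHS]stack_adj //; move/fintype.subsetP: Lv => /(_ _ sL).
  by rewrite inE.
rewrite -[s :: residue _ _]cat1s -[s :: w]cat1s !stack_cat IHw //.
exact: fintype.subset_trans (subsetIl _ _) Lv.
Qed.

Lemma residue_red L w : reduced w -> reduced (residue L w) /\
  forall v, v \in L -> ~~ top (stack v (residue L w)).
Proof.
elim: w L => [|[u a] w IHw] L rw /=; first by do 2?split.
move: rw; rewrite red_cons /= => -[a1 tu rw].
case: ifP => uL; first exact: IHw.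
have [rr hr] := IHw (L :&: link u) rw; split.
  by rewrite red_cons /= stack_residue ?subsetIr.
move=> v vL; have [uv|uv] := boolP (e u v).
  by rewrite stack_adj ?hr ?inE ?vL ?uv //= e_sym.
by rewrite stack_nadj //= 1?e_sym //; apply: contraFneq uL => ->.
Qed.

Lemma residue_id L w : over (~: L) w -> residue L w = w.
Proof.
elim: w L => [|s w IHw] L //=; rewrite inE => /andP[/negPf-> wL].
by rewrite IHw //; apply: over_sub wL; rewrite finset.setCS subsetIl.
Qed.

(** Since [v] is never in the current set, its syllable is skipped, and skipping it intersects that
    set with [link v]. *)
Lemma shrink_link (L : {set V}) v w : v \in map tag w -> v \notin L ->
  shrink L w \subset link v.
Proof.
elim: w L => [|s w IHw] L //=; rewrite inE => /orP[/eqP vs|vw] vL.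
  rewrite -vs (negPf vL).
  exact: fintype.subset_trans (shrink_sub _ _) (subsetIr _ _).
by case: ifP => _; apply: IHw; rewrite // inE (negPf vL).
Qed.

Definition headless (L : {set V}) (x : gp) := forall v, v \in L -> hd v x = 1.

Lemma red_cat_over L w w' : reduced w -> over L w -> reduced w' ->
  (forall v, v \in L -> ~~ top (stack v w')) -> reduced (w ++ w').
Proof.
move=> + + rw' hw'; elim: w => [//|s w IHw].
rewrite cat_cons !red_cons => -[s1 ts rw] /andP[sL wL].
split=> //; last exact: IHw.
by rewrite stack_cat; case: stack ts => //= _; exact: hw'.
Qed.

Lemma headless_red L w : reduced w -> headless L (ev w) ->
  forall v, v \in L -> ~~ top (stack v w).
Proof. by move=> rw hw v /hw/eqP; rewrite hd_eq1. Qed.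

(** If [q'^-1 * q] were non-trivial, the first syllable of a reduced word for it would remain in
    front of [y] and give [y'] a head in [L]. Geometrically, [q] is the gate of the element on the
    subgroup of [L]. *)
Lemma decompose_uniq L q y q' y' : supported L q -> supported L q' ->
  headless L y -> headless L y' -> q * y = q' * y' -> q = q' /\ y = y'.
Proof.
move=> pq pq' hy hy' E; suff qq : q = q' by split=> //; apply: (mulgI q); rewrite {2}qq.
have yE : q'^-1 * q * y = y' by rewrite -mulgA E mulKg.
suff : q'^-1 * q = 1 by move=> h; rewrite -[RHS]mulg1 -h mulVKg.
have /supported_red[w [rw wL ew]] := supportedM (supportedV pq') pq; rewrite -{}ew in yE *.
have [wy rwy wyE] := red_repr y; rewrite wyE in yE hy.
have hwy := headless_red rwy hy.
case: w rw wL yE => [//|[v a] w] rw /= /andP[vL wL].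
have rc : reduced ((existT _ v a :: w) ++ wy).
  by apply: red_cat_over rwy hwy; rewrite //= vL.
rewrite -evalM => yE; move: (hy' v vL); rewrite -yE => /eqP.
by rewrite hd_eq1 // -/(syl a) cat_cons stack_consl.
Qed.

(** * Walks, gates and carriers in the Cayley graph *)

Section Walks.
Variable S : forall u, set (G u).
Local Notation gens := (@gp_gens V e G S).
Local Notation adj := (cayley_adj gens).
Local Notation walk := (cayley_walk gens).

Lemma adj_mulr x y : adj x y ->
  exists v (s : G v), y = x * incl e s /\ forall z, adj z (z * incl e s).
Proof.
case=> t [v _ [s Ss <-{t}]] [->|->].
  exists v, s; split=> // z; exists (incl e s); last by left.
  by exists v => //; exact: imageP.
exists v, s^-1; rewrite inclV mulgK; split=> // z.
exists (incl e s); last by right; rewrite mulgVK.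
by exists v => //; exact: imageP.
Qed.

(** Each edge moves only one factor: if it would give [y1] a head in [L], then by [hd_mulr] its
    label commutes with [y1] and is absorbed by [q1]. That lengths add up is the gate property used
    in [bottleneck]. *)
Lemma walk_split L n x y q1 y1 : x = q1 * y1 -> supported L q1 -> headless L y1 ->
  walk n x y -> exists q2 y2 n1 n2,
  [/\ y = q2 * y2, supported L q2 & headless L y2] /\
  [/\ (n1 + n2)%N = n, walk n1 q1 q2 & walk n2 y1 y2].
Proof.
elim: n x q1 y1 => [|n IHn] x q1 y1 xE p1 h1 /=.
  by move=> <-; exists q1, y1, 0, 0.
case=> z /adj_mulr[v [s [zE adjs]]] wz.
have [hs|/existsNP[t /not_implyP[tL ht]]] := EM (headless L (y1 * incl e s)).
  have [|q2 [y2 [n1 [n2 [h [<- w1 w2]]]]]] := IHn z q1 (y1 * incl e s) _ p1 hs wz.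
    by rewrite zE xE mulgA.
  exists q2, y2, n1, n2.+1; split=> //; split=> //; first by rewrite addnS.
  by exists (y1 * incl e s).
have [|tv] := hd_mulr (t := t) (v := v) (s := s) (x := y1); first by rewrite h1.
rewrite h1 // incl1 invg1 mul1g => /supported_link_commute-/(_ s) cs; subst v.
have p1' : supported L (q1 * incl e s) by apply: supportedM => //; exact: supported_incl.
have [|q2 [y2 [n1 [n2 [h [<- w1 w2]]]]]] := IHn z (q1 * incl e s) y1 _ p1' h1 wz.
  by rewrite zE xE -!mulgA cs.
exists q2, y2, n1.+1, n2; split=> //; split=> //.
by exists (q1 * incl e s).
Qed.

Definition star (v : V) : {set V} := v |: link v.

(** By [hd_mulr], the first edge changing [hd t] starts in the carrier. The strict inequality feeds
    the minimality argument of [hd_nested]. *)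
Lemma walk_cross n x y t : walk n x y -> hd t x <> hd t y ->
  exists z n1 n2, [/\ supported (star t) z, walk n1 x z, walk n2 z y,
    (n1 + n2)%N = n & (n1 < n)%N].
Proof.
elim: n x => [|n IHn] x /=; first by move=> ->.
case=> z xz wz hxy; have [h|h] := EM (hd t x = hd t z); last first.
  exists x, 0, n.+1; split=> //; last by exists z.
  have [v [s [zE _]]] := adj_mulr xz; rewrite zE in h.
  have [tv pl] := hd_mulr (nesym h).
  subst v; rewrite -[x](mulVKg (incl e (hd t x))); apply: supportedM.
    by apply: supported_incl; rewrite !inE eqxx.
  exact: supported_sub (finset.subsetUr _ _) pl.
have [|z' [n1 [n2 [p w1 w2 <- lt]]]] := IHn z wz; first by rewrite -h.
by exists z', n1.+1, n2; split=> //; exists z.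
Qed.

End Walks.

(** * Gates and bottlenecks *)

Section Bottleneck.
Variables (S : forall u, set (G u)) (genS : generates (@gp_gens V e G S)).
Local Notation dist := (cayley_dist genS).
Local Notation walk := (cayley_walk (@gp_gens V e G S)).
Variables (z : gp) (u : V) (a : G u) (C : nat).
Hypotheses (a1 : a <> 1)
  (hd_right : forall q, supported (star u) q -> hd u (z * q) = a)
  (hd_left : forall q, supported (star u) q -> hd u (z^-1 * q) = 1)
  (gate_bounded : forall q, supported (star u) q -> exists c y : gp,
    [/\ z * q = c * y, supported (star u) c, headless (star u) y & (dist 1 c <= C)%N]).

(* Otherwise the hyperplanes of [star u] and [z * star u] would both separate
   [x] from the two carriers, and a shortest path from [x] to the union of the
   carriers could be shortened. *)
Lemma hd_nested (x : gp) : hd u x <> a -> hd u (z^-1 * x) = 1.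
Proof.
move=> xa; apply: contrapT => zx1.
suff none n y : walk n x y -> ~ (supported (star u) y \/ supported (star u) (z^-1 * y)).
  by apply: (none _ _ (cayley_distP genS x 1)); left; exact: supported1.
elim/ltn_ind: n y => n IHn y w [py|py].
  have w' := cayley_walk_mul z^-1 w.
  have [|t [n1 [n2 [pt w1 _ _ lt]]]] := walk_cross (t := u) w'.
    by rewrite (hd_left py).
  apply: (IHn n1 lt (z * t)); last by right; rewrite mulKg.
  by have := cayley_walk_mul z w1; rewrite mulVKg.
have [|t [n1 [n2 [pt w1 _ _ lt]]]] := walk_cross (t := u) w.
  by rewrite -[y](mulVKg z) (hd_right py).
by apply: (IHn n1 lt t) => //; left.
Qed.

(** A geodesic meets the carrier of [star u] at [s], then its translate by [z] at [z * t]. Between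
    these it can be rerouted through the gate [c] of [z * t], which is within [C] of [1]; the detour
    from [c] to [1] is paid twice. *)
Lemma bottleneck (x y : gp) : hd u x <> a -> hd u (z^-1 * y) <> 1 ->
  (dist x 1 + dist 1 y <= dist x y + (C + C))%N.
Proof.
move=> xa y1; have w := cayley_walk_mul z^-1 (cayley_distP genS x y).
have [|t [n1 [n2 [pt w1 w2 n12 _]]]] := walk_cross (t := u) w.
  by rewrite hd_nested //; exact: nesym.
have {}w1 : walk n1 x (z * t) by have := cayley_walk_mul z w1; rewrite !mulVKg.
have {w2} := cayley_dist_min genS w2; rewrite -{1}(cayley_dist_mul genS z) mulVKg => w2.
have [|s [m1 [m2 [ps v1 v2 m12 _]]]] := walk_cross (t := u) w1.
  by rewrite hd_right.
have [c [r [zt pc hr dc]]] := gate_bounded pt.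
have h1 : headless (star u) 1 by move=> v _; exact: hd1.
have [c' [r' [k1 [k2 [[zt' pc' hr'] [k12 x1 x2]]]]]] :=
  walk_split (esym (mulg1 s)) ps h1 v2.
have [cc rr] : c = c' /\ r = r'.
  by apply: decompose_uniq pc pc' hr hr' _; rewrite -zt.
subst c' r'.
have d1 := cayley_dist_min genS v1.
have d2 := cayley_dist_min genS x1.
have d3 := cayley_dist_min genS x2.
have d4 : dist c (z * t) = dist 1 r by rewrite zt -{1}[c]mulg1 cayley_dist_mul.
have t1 := cayley_dist_triangle genS s x 1.
have t2 := cayley_dist_triangle genS c s 1.
have t3 := cayley_dist_triangle genS c 1 y.
have t4 := cayley_dist_triangle genS (z * t) c y.
rewrite -n12 -m12 -k12; apply: leq_trans (leq_add t1 t3) _.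
have ds : (dist s 1 <= k1 + C)%N.
  by apply: leq_trans t2 _; rewrite (cayley_dist_sym genS c 1); apply: leq_add.
have dy : (dist c y <= k2 + n2)%N.
  by apply: leq_trans t4 _; rewrite d4; apply: leq_add.
apply: leq_trans (leq_add (leq_add d1 ds) (leq_add dc dy)) _; lia.
Qed.

(** An edge leaving the sector of [a] starts in the carrier of [star u], all of which lies, by
    [hd_left], in sector [1] of the next wall. *)
Lemma hd_step (x y : gp) : hd u (z^-1 * x) <> 1 -> cayley_adj (@gp_gens V e G S) x y ->
  hd u y <> 1.
Proof.
move=> zx xy y1; have xa : hd u x = a by apply: contrapT => /hd_nested.
have [v [s [yE _]]] := adj_mulr xy.
have [|uv pl] := hd_mulr (t := u) (v := v) (s := s) (x := x).
  by rewrite -yE y1 xa; exact: nesym.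
subst v; apply: zx; rewrite -[x](mulVKg (incl e (hd u x))); apply: hd_left.
apply: supportedM; first by apply: supported_incl; rewrite !inE eqxx.
exact: supported_sub (finset.subsetUr _ _) pl.
Qed.

End Bottleneck.

(** * Inverses and concatenations of reduced words *)

Section Tags.

(** Apart from the non-triviality of syllables, being reduced depends only on the pattern of blanks,
    which [word_inv] reverses although it changes the stored syllables. *)
Definition tagmask (v : V) (l : seq V) := [seq t == v | t <- l & ~~ e v t].

Lemma isSome_stack v w : map isSome (stack v w) = tagmask v (map tag w).
Proof.
rewrite /stack /tagmask filter_map -!map_comp; apply: eq_map => s /=.
by rewrite /mark; case: eqP.
Qed.

Lemma topE l : top l = head false (map isSome l).
Proof. by case: l => [|[?|] l]. Qed.

Lemma sorted_nnE l :
  sorted nn l = sorted (fun x y => ~~ (x && y)) (map isSome l).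
Proof. by rewrite sorted_map. Qed.

Lemma tag_word_inv (w : word) : map tag (word_inv w) = rev (map tag w :> seq V).
Proof.
by rewrite /word_inv map_rev -map_comp; congr rev; apply: eq_map => -[].
Qed.

Lemma isSome_stack_inv v w :
  map isSome (stack v (word_inv w)) = map isSome (rev (stack v w)).
Proof.
by rewrite map_rev !isSome_stack tag_word_inv /tagmask filter_rev map_rev.
Qed.

Lemma top_stack_inv v w : top (stack v (word_inv w)) = top (rev (stack v w)).
Proof. by rewrite !topE isSome_stack_inv. Qed.

Lemma red_word_inv w : reduced w -> reduced (word_inv w).
Proof.
case=> aw sw; split=> [|v].
  rewrite /word_inv all_rev all_map; apply: sub_all aw => -[v a] /=.
  by rewrite invg_eq1.
rewrite sorted_nnE isSome_stack_inv -sorted_nnE rev_sorted.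
by apply: sub_sorted (sw v) => x y; rewrite /nn andbC.
Qed.

Lemma word_inv_cat (w w' : word) : word_inv (w ++ w') = word_inv w' ++ word_inv w.
Proof. by rewrite /word_inv map_cat rev_cat. Qed.

Lemma stack_nil v w : v \in map tag w -> stack v w != [::].
Proof.
move=> vw; rewrite -size_eq0 -(size_map isSome) isSome_stack size_map size_eq0.
by rewrite -has_filter; apply/hasP; exists v => //; rewrite e_irr.
Qed.

Lemma top_notin v w : v \notin map tag w -> ~~ top (stack v w).
Proof.
move=> vw; case E : stack => [|[s|]r] //.
by have [m [t [wE _ sv _]]] := stack_top E; rewrite wE map_cat mem_cat inE sv eqxx orbT in vw.
Qed.

Lemma toprev_notin v w : v \notin map tag w -> ~~ top (rev (stack v w)).
Proof. by move=> vw; rewrite -top_stack_inv top_notin // tag_word_inv mem_rev. Qed.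

(** A [v]-syllable of [w1] could meet one of [w3] only across an empty [stack v w2], but [v] occurs
    in [w2]. *)
Lemma red_glue (w1 w2 w3 : word) : {subset map tag w1 <= map tag w2} ->
  reduced (w1 ++ w2) -> reduced (w2 ++ w3) -> reduced (w1 ++ w2 ++ w3).
Proof.
move=> sub [a12 s12] [a23 s23]; split=> [|v].
  by move: a12; rewrite !all_cat => /andP[-> _]; rewrite -all_cat.
rewrite stack_cat nn_sorted_cat s23.
have := s12 v; rewrite stack_cat nn_sorted_cat => /and3P[-> _ t12] /=.
have [/sub/stack_nil|/toprev_notin/negPf-> //] := boolP (v \in map tag w1).
by rewrite stack_cat; case: (stack v w2) t12.
Qed.

Definition wpow (w : word) n := iter n (cat w) [::].

Lemma ev_wpow w n : ev (wpow w n) = ev w ^+ n.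
Proof. by elim: n => [//|n IHn]; rewrite /= evalM IHn expgS. Qed.

Lemma wpowD w m n : wpow w (m + n) = wpow w m ++ wpow w n.
Proof. by elim: m => [//|m IHm]; rewrite addSn /= IHm catA. Qed.

Lemma wpowSr w n : wpow w n.+1 = wpow w n ++ w.
Proof. by rewrite -addn1 wpowD /= cats0. Qed.

End Tags.

(** * Powers of an axial word *)

Section Axis.
Variable K : {set V}.

Definition nonadj (x y : V) := [&& x \in K, y \in K, x != y & ~~ e x y].

Hypotheses (K_conn : {in K &, forall x y, connect nonadj x y})
  (K_nbr : forall x, x \in K -> exists y, nonadj x y).

Definition common_link : {set V} := [set x | [forall y in K, e y x]].

(* The third condition says that [w] followed by [w] is again reduced. *)
Definition axial (w : word) : Prop :=
  [/\ reduced w, map tag w =i K & forall v, ~~ (top (stack v w) && top (rev (stack v w)))].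

Lemma axial_inv w : axial w -> axial (word_inv w).
Proof.
move=> [rw tw cw]; split; first exact: red_word_inv.
  by move=> v; rewrite tag_word_inv mem_rev tw.
by move=> v; rewrite -(top_stack_inv v (word_inv w)) word_invK top_stack_inv andbC.
Qed.

Lemma axial_red2 w : axial w -> reduced (w ++ w).
Proof.
move=> [[aw sw] _ cw]; split; first by rewrite all_cat aw.
by move=> v; rewrite stack_cat nn_sorted_cat sw /= andbC.
Qed.

Lemma axial_red_cat w n w' : axial w -> reduced (w ++ w') -> reduced (wpow w n ++ w ++ w').
Proof.
move=> aw; elim: n w' => [//|n IHn] w' rw'.
rewrite wpowSr -catA; apply: IHn; apply: red_glue => //; exact: axial_red2.
Qed.

Lemma axial_wpow w n : axial w -> reduced (wpow w n).
Proof.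
move=> aw; case: n => [|n]; first by split.
have := @axial_red_cat w n [::] aw; rewrite !cats0 -wpowSr; apply.
by case: aw.
Qed.

(* As [K] is connected for non-adjacency, each further copy of [w] expels from
   [L] the neighbours, in that graph, of the vertices of [K] already missing. *)
Lemma shrink_wpow_link w (L : {set V}) : map tag w =i K ->
  (exists2 v, v \in K & v \notin L) ->
  exists n, shrink L (wpow w n) \subset common_link.
Proof.
move=> tw [v0 v0K v0L].
have mono m n : (m <= n)%N ->
    shrink L (wpow w n) \subset shrink L (wpow w m).
  by move=> /subnKC <-; rewrite wpowD shrink_cat shrink_sub.
have out x : x \in K -> exists n, x \notin shrink L (wpow w n).
  move=> xK; have /connectP[p] := K_conn v0K xK.
  elim/last_ind: p x xK => [|p y IHp] x xK; first by move=> _ ->; exists 0.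
  rewrite rcons_path last_rcons => /andP[pp ly] xE; subst y.
  have /and4P[lK _ lx nlx] := ly.
  have [n ln] := IHp _ lK pp erefl; exists n.+1.
  rewrite wpowSr shrink_cat; apply: contra nlx => xs.
  have := shrink_link (w := w) (v := last v0 p) _ ln; rewrite tw => /(_ lK).
  by move=> /fintype.subsetP/(_ _ xs); rewrite inE.
have [f fP] : {f : V -> nat & forall x, x \in K -> x \notin shrink L (wpow w (f x))}.
  apply: (@choice _ _ (fun x n => x \in K -> x \notin shrink L (wpow w n))) => x.
  by have [xK|xK] := boolP (x \in K); [have [n] := out x xK; exists n|exists 0].
exists (\max_x f x).+1; apply/fintype.subsetP => x xs; rewrite inE.
apply/'forall_implyP => y yK; rewrite wpowSr shrink_cat in xs.
have yn : y \notin shrink L (wpow w (\max_x f x)).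
  by apply: contra (fP y yK); apply/fintype.subsetP/mono/leq_bigmax.
have := shrink_link (w := w) (v := y) _ yn; rewrite tw => /(_ yK).
by move=> /fintype.subsetP/(_ _ xs); rewrite inE.
Qed.

Lemma star_avoids u : u \in K -> exists2 v, v \in K & v \notin star u.
Proof.
move=> /K_nbr[y /and4P[_ yK uy nuy]]; exists y => //.
by rewrite !inE negb_or eq_sym uy.
Qed.

(* Apply [residue] along [star u] to a large power of [word_inv w]: what is
   left still ends with [word_inv w]; then take inverses. *)
Lemma axial_absorb w u : axial w -> u \in K ->
  exists n, forall m, (n <= m)%N -> forall q, supported (star u) q ->
  exists2 w', reduced (w ++ w') & ev w ^+ m * q = ev (w ++ w').
Proof.
move=> aw uK; have av := axial_inv aw; set v := word_inv w in av.
have [_ tv _] := av.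
have [n sn] := shrink_wpow_link tv (star_avoids uK).
exists n.+1 => m nm q pq; pose p := wpow v n.+1.
have rp : reduced p by exact: axial_wpow.
have [rr hr] := residue_red (star u) rp.
(* After [n] copies only the common link can still be emitted; it misses [K], so the last copy of
   [v] passes whole into the residue. *)
have residueE : residue (star u) p = residue (star u) (wpow v n) ++ v.
  rewrite /p wpowSr residue_cat; congr (_ ++ _); apply: residue_id.
  apply/allP => s sv; rewrite inE; apply/negP => /(fintype.subsetP sn).
  have sK : tag s \in K by rewrite -tv map_f.
  by rewrite inE => /'forall_implyP/(_ _ sK); rewrite e_irr.
(* Both [q^-1] and the emitted part lie over [star u]; recombined into a reduced [x], they cannot
   cancel into the headless residue. *)
have /supported_red[x [rx xL ex]] : supported (star u) (q^-1 * ev (emit (star u) p)).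
  apply: supportedM; first exact: supportedV.
  by exists (emit (star u) p) => //; exact: emit_over.
have rc := red_cat_over rx xL rr hr; rewrite residueE catA in rc.
pose w' := word_inv (x ++ residue (star u) (wpow v n)).
have wE : w ++ w' = word_inv ((x ++ residue (star u) (wpow v n)) ++ v).
  by rewrite word_inv_cat word_invK.
have rw' : reduced (w ++ w') by rewrite wE; exact: red_word_inv.
have ew' : ev w ^+ n.+1 * q = ev (w ++ w').
  rewrite wE ev_word_inv -catA -residueE evalM ex -mulgA -emit_residue invgM invgK.
  by congr (_ * _); rewrite ev_wpow ev_word_inv expVgn invgK.
set k := (m - n.+1)%N; have kE : w ++ wpow w k ++ w' = wpow w k ++ w ++ w'.
  by rewrite !catA -wpowSr.
exists (wpow w k ++ w'); rewrite kE; first exact: (axial_red_cat k aw rw').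
by rewrite -{1}(subnK nm) expgnDr -mulgA ew' (evalM _ (wpow w k)) ev_wpow.
Qed.

Lemma common_link_sub v : v \in K -> common_link \subset link v.
Proof.
move=> vK; apply/fintype.subsetP => x; rewrite !inE.
by move=> /'forall_implyP/(_ v vK).
Qed.

Lemma common_link_commute w f : map tag w =i K -> supported common_link f ->
  commute (ev w) f.
Proof.
move=> tw pf; have {tw}: over K w by apply/allP => s sw; rewrite -tw map_f.
elim: w => [|[v b] w IHw] /=; first by move=> _; exact/commute_sym/commute1.
move=> /andP[vK wK]; rewrite eval_cons; apply/commute_sym/commuteM.
  apply/commute_sym/supported_link_commute; apply: supported_sub pf; exact: common_link_sub.
exact/commute_sym/IHw.
Qed.

Lemma supportedX L x n : supported L x -> supported L (x ^+ n).
Proof.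
by move=> px; elim: n => [|n IHn]; [exact: supported1|rewrite expgS; exact: supportedM].
Qed.

Lemma axial_gates (S : forall u, set (G u)) (genS : generates (@gp_gens V e G S))
    w u (f : gp) :
  axial w -> u \in K -> top (stack u w) ->
  supported common_link f -> finite_set [set x | supported common_link x] ->
  exists N (a : G u) C, let z := (ev w * f) ^+ N in
  [/\ (0 < N)%N, a <> 1,
      forall q, supported (star u) q -> hd u (z * q) = a,
      forall q, supported (star u) q -> hd u (z^-1 * q) = 1 &
      forall q, supported (star u) q -> exists c y : gp,
        [/\ z * q = c * y, supported (star u) c, headless (star u) y &
            (cayley_dist genS 1 c <= C)%N]].
Proof.
move=> aw uK tu pf fin; have [rw tw cw] := aw.
have [n1 abs1] := axial_absorb aw uK.
have [n2 abs2] := axial_absorb (axial_inv aw) uK.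
have [k sk] := shrink_wpow_link tw (star_avoids uK).
(* The first [k] copies of [w] leave only the common link to emit; the others are numerous enough
   for both uses of [axial_absorb]. The sector is the front [u]-syllable of [w]. *)
pose N := (k + (n1 + n2).+1)%N; exists N, (topcoef u (stack u w)).
have cf : commute (ev w) f by exact: common_link_commute.
have linkS : common_link \subset star u.
  exact: fintype.subset_trans (common_link_sub uK) (finset.subsetUr _ _).
have pfN q : supported (star u) q -> supported (star u) (f ^+ N * q).
  by apply: supportedM; apply: supportedX; exact: supported_sub pf.
(* Every gate will be this fixed element times an element of the finite group on the common link,
   whence a uniform [C]. *)
pose E := ev (emit (star u) (wpow w k)).
have [C CP] : exists C, forall c, supported common_link c ->
    (cayley_dist genS 1 (E * c) <= C)%N.
  have /finite_seqP[s sE] := fin.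
  exists (\max_(c <- s) cayley_dist genS 1 (E * c)) => c pc.
  apply: (leq_bigmax_seq (F := fun c => cayley_dist genS 1 (E * c))) => //.
  by have : [set x | supported common_link x]%classic c by []; rewrite sE.
exists C => z.
have zE : z = ev w ^+ N * f ^+ N by rewrite /z expgMn.
split=> //; first by rewrite /N addnS.
- by apply/eqP; rewrite red_topcoef // tu.
- move=> q pq; have [|w' rw' wE] := abs1 N _ _ (pfN q pq).
    by rewrite /N; lia.
  rewrite zE -mulgA wE hd_red // stack_cat.
  by case: stack tu => [|[?|] ?].
- move=> q pq; have pq' : supported (star u) (f ^- N * q).
    by apply: supportedM pq; apply/supportedV/supportedX/(supported_sub linkS).
  have [|w' rw' wE] := abs2 N _ _ pq'; first by rewrite /N; lia.
  have -> : z^-1 * q = ev (word_inv w) ^+ N * (f ^- N * q).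
    rewrite ev_word_inv expVgn zE (commuteX2 N N cf) invgM mulgA.
    by [].
  (* As [w] is axial and begins with a [u]-syllable, it does not end with one; so the non-empty
     stack at [u] of its inverse has a blank on top. *)
  rewrite wE; apply/eqP; rewrite hd_eq1 // stack_cat.
  have : stack u (word_inv w) != [::].
    by apply: stack_nil; rewrite tag_word_inv mem_rev tw.
  have := cw u; rewrite tu -top_stack_inv /=.
  by case: stack => [|[?|] ?].
- move=> q pq; have [|w' rw' wE] := abs1 (n1 + n2).+1 _ _ (pfN q pq).
    by lia.
  have rk := axial_red_cat k aw rw'.
  have zqE : z * q = ev (wpow w k ++ w ++ w').
    by rewrite zE -mulgA evalM -wE ev_wpow [RHS]mulgA -expgnDr.
  have [rr hr] := residue_red (star u) rk.
  pose r := emit (shrink (star u) (wpow w k)) (w ++ w').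
  exists (E * ev r), (ev (residue (star u) (wpow w k ++ w ++ w'))); split.
  + by rewrite zqE (emit_residue (star u)) emit_cat evalM.
  + apply: supportedM; first by exists (emit (star u) (wpow w k)); rewrite ?emit_over.
    exists r => //; exact: over_sub (shrink_sub _ _) (emit_over _ _).
  + by move=> v /hr h; apply/eqP; rewrite hd_eq1.
  + by apply: CP; exists r => //; exact: over_sub sk (emit_over _ _).
Qed.

Lemma supported_parabolic (L : {set V}) : [set x | supported L x] `<=` @parabolic V e G L.
Proof.
move=> x [w wL <-] {x}; have [p1 pM _] := generated_subgroup
  (\bigcup_(u in [set u | u \in L]) @vertex_group V e G u).
elim: w wL => [_|[v b] w IHw] /=; first exact: p1.
move=> /andP[vL wL]; rewrite eval_cons; apply: pM; last exact: IHw.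
by apply: sub_gen_smallest; exists v => //; exists b.
Qed.

(** The stack at [u] is an invariant of the element and grows linearly along the powers of [w],
    which are therefore distinct. *)
Lemma axial_infinite w u : axial w -> u \in K -> ~ finite_set (@parabolic V e G K).
Proof.
move=> aw uK fin; have [_ tw _] := aw.
have pw n : parabolic K (ev w ^+ n).
  apply: supported_parabolic; apply: supportedX; exists w => //.
  by apply/allP => s sw; rewrite -tw map_f.
have sz n : size (nf (ev w ^+ n) u) = (n * size (stack u w))%N.
  rewrite -ev_wpow nf_red; last exact: axial_wpow.
  rewrite /stacks; elim: n => [//|n IHn].
  by rewrite [wpow _ _]/(w ++ wpow w n) stack_cat size_cat IHn.
apply: infinite_nat; rewrite -(_ : (fun n => ev w ^+ n) @^-1` parabolic K = setT).
  apply: finite_preimage fin => m n _ _ mn.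
  have := sz m; rewrite mn sz => /eqP; rewrite eqn_mul2r size_eq0.
  by rewrite (negPf (stack_nil _)) ?tw // => /eqP.
by apply/seteqP; split=> // n _; exact: pw.
Qed.

End Axis.

(** * Cyclically reduced words *)

Lemma emove_shift l t s r : all (fun x : syll => e (tag s) (tag x)) t ->
  clos_refl_trans word (emove e (G:=G)) (l ++ t ++ s :: r) (l ++ s :: t ++ r).
Proof.
elim: t l => [|x t IHt] l /=; first by move=> _; exact: rt_refl.
move=> /andP[sx at_]; apply: rt_trans (rt_step _ _ _ _ _).
  by have := IHt (rcons l x) at_; rewrite !cat_rcons; exact.
case: x s sx {IHt at_} => [u a] [v b] /= vu.
by rewrite -!/(syl _); apply: EExchange; rewrite e_sym.
Qed.

Lemma merge_size (l t r : word) s s' : all (fun x : syll => e (tag s) (tag x)) t ->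
  tag s' = tag s -> exists2 w', clos_refl_trans word (emove e (G:=G))
    (l ++ s' :: t ++ s :: r) w' & (size w' < size (l ++ s' :: t ++ s :: r))%N.
Proof.
case: s s' => [v b] [u a] at_ /= uv; subst u.
exists (l ++ syl (a * b) :: t ++ r); last first.
  by rewrite !size_cat /= !size_cat /=; lia.
have := @emove_shift (rcons l (syl a)) t (syl b) r at_; rewrite !cat_rcons => h.
by apply: rt_trans h (rt_step _ _ _ _ _); exact: EMerge.
Qed.

Lemma emove_cat_closure l w w' : clos_refl_trans word (emove e (G:=G)) w w' ->
  clos_refl_trans word (emove e (G:=G)) (l ++ w) (l ++ w').
Proof.
elim=> [x y xy|x|x y z _ xy _]; last exact: rt_trans.
  by apply: rt_step; have := emove_cat l [::] xy; rewrite !cats0.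
exact: rt_refl.
Qed.

Lemma graphically_reduced_red w : graphically_reduced e w -> reduced w.
Proof.
elim: w => [|[v b] w IHw] gw; first by split.
rewrite red_cons /=; split.
- apply/eqP => b1; have /gw : clos_refl_trans word (emove e (G:=G)) (syl b :: w) w.
    by rewrite b1; apply: rt_step; exact: (EDelete e [::] w v).
  by rewrite /= ltnn.
- case E : stack => [|[s|] r] //; have [m [t [wE am sv _]]] := stack_top E.
  rewrite -sv in am; have [] := @merge_size [::] m t s (syl b) am; first by rewrite sv.
  by move=> w'; rewrite /= -wE => /gw; rewrite leqNgt => /negPf->.
- apply: IHw => w' ww'; have := gw (syl b :: w'); rewrite /= ltnS; apply.
  exact: (@emove_cat_closure [:: syl b]).
Qed.

Lemma cmove_emove w w' : clos_refl_trans word (emove e (G:=G)) w w' ->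
  clos_refl_trans word (cmove e (G:=G)) w w'.
Proof.
elim=> [x y xy|x|x y z _ xy _]; [|exact: rt_refl|exact: rt_trans].
by apply: rt_step; left.
Qed.

(** The blank makes the front and the rear [v]-syllables distinct; a cyclic permutation lets them
    merge, which would shorten [w]. *)
Lemma cyclically_reduced_top w v : cyclically_reduced e w ->
  None \in stack v w -> ~~ (top (stack v w) && top (rev (stack v w))).
Proof.
move=> cw Nw; apply/negP => /andP[].
case E : stack Nw => [|[s|] r] // Nw _.
have [m [t [wE am sv tr]]] := stack_top E.
have {}Nw : None \in r by move: Nw; rewrite inE.
rewrite rev_cons; case Er : (rev r) => [|[s'|] r'] //=.
  by move: Nw; rewrite -mem_rev Er.
(* The rear [v]-syllable is found as the front one of the inverse of [t], hence occurs in [t] as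
   [c^-1]. *)
move=> _; have : top (stack v (word_inv t)) by rewrite top_stack_inv tr Er.
case E' : stack => [|[s1|] r1] // _.
have [m' [t' [tE am' sv' _]]] := stack_top E'.
case: s1 sv' tE {E'} => [v1 c] /= vE tE; subst v1.
have {}tE : t = word_inv t' ++ syl c^-1 :: word_inv m'.
  by rewrite -[t]word_invK tE word_inv_cat /word_inv /= rev_cons cat_rcons.
have am2 : all (fun x : syll => e v (tag x)) (word_inv m').
  by rewrite /word_inv all_rev all_map; apply: sub_all am' => -[].
pose mm := word_inv m' ++ m.
have [|//|w' ww'] := @merge_size [::] mm (word_inv t') s (syl c^-1).
  by rewrite sv all_cat am2 am.
suff sE : size (syl c^-1 :: mm ++ s :: word_inv t') = size w.
  rewrite /= in sE ww' *; rewrite sE ltnNge => /negP; apply; apply: cw.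
  apply: rt_trans (cmove_emove ww'); apply: rt_step; right.
  exists (m ++ s :: word_inv t'), (syl c^-1 :: word_inv m').
  by rewrite wE tE /mm /= -!catA.
by rewrite wE tE /mm /= !size_cat /= !size_cat /=; lia.
Qed.

Lemma mem_tagE v w : (v \in map tag w) = has isSome (stack v w).
Proof.
rewrite -[RHS](has_map isSome id) isSome_stack /tagmask has_map has_filter.
rewrite -has_filter; apply/idP/hasP => [vw|[x]].
  by exists v; rewrite ?mem_filter ?e_irr //=.
by rewrite mem_filter => /andP[_ xw] /= /eqP <-.
Qed.

Lemma red_tags w w' : reduced w -> reduced w' -> ev w = ev w' -> map tag w =i map tag w'.
Proof.
move=> rw rw' ww' v; rewrite !mem_tagE -!/(stacks _ v).
by rewrite -!nf_red // ww'.
Qed.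

Lemma sorted_notin v w : v \notin map tag w -> sorted nn (stack v w).
Proof.
elim: w => [//|s w IHw]; rewrite inE negb_or eq_sym => /andP[sv /IHw sw].
have [vs|vs] := boolP (e v (tag s)); first by rewrite stack_adj.
by rewrite stack_nadj //=; case: (stack v w) sw.
Qed.

(** * Splitting off a component for non-adjacency *)

Section Component.
Variables (K L : {set V}).
Hypotheses (KL : K \subset L)
  (K_adj : forall x y, x \in L -> x \notin K -> y \in K -> e y x)
  (K_nbr : forall x, x \in K -> exists y, nonadj K x y).

Lemma component_split w : over L w -> exists wK f,
  [/\ wK = [seq s <- w | tag s \in K], supported (common_link K) f & ev w = ev wK * f].
Proof.
elim: w => [_|[v b] w IHw] /=.
  by exists [::], 1; rewrite mulg1; split=> //; exact: supported1.
move=> /andP[vL /IHw[wK [f [-> pf wE]]]]; case: ifP => vK.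
  exists (syl b :: [seq s <- w | tag s \in K]), f; split=> //.
  by rewrite !eval_cons wE mulgA.
have pb : supported (common_link K) (incl e b).
  apply: supported_incl; rewrite inE; apply/'forall_implyP => y yK.
  by apply: K_adj; rewrite ?vK.
exists [seq s <- w | tag s \in K], (incl e b * f); split=> //; first exact: supportedM.
rewrite eval_cons wE !mulgA; congr (_ * _).
elim: {wE IHw} w => [|[u c] w IHw] /=; first by rewrite mulg1 mul1g.
case: ifP => // uK; rewrite eval_cons mulgA -[RHS]mulgA -IHw !mulgA.
by congr (_ * _); apply/incl_commute; rewrite e_sym K_adj ?vK.
Qed.

Lemma stack_component w v : over L w -> v \in K ->
  stack v [seq s <- w | tag s \in K] = stack v w.
Proof.
move=> /allP wL vK; rewrite /stack -filter_predI; congr map.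
apply: eq_in_filter => s sw /=; have [//|/=] := boolP (e v (tag s)).
by apply: contraNT => sK; apply: K_adj => //; exact: wL.
Qed.

(** A vertex [v] of [K] has a non-neighbour in [K]; its occurrence in [w] is the blank required by
    [cyclically_reduced_top]. *)
Lemma axial_component w : reduced w -> cyclically_reduced e w -> map tag w =i L ->
  axial K [seq s <- w | tag s \in K].
Proof.
move=> [aw sw] cw tw; set wK := [seq s <- w | tag s \in K].
have wL : over L w by apply/allP => s sw'; rewrite -tw map_f.
have tK v : (v \in map tag wK) = (v \in K).
  apply/mapP/idP => [[s]|vK]; first by rewrite mem_filter => /andP[sK _] ->.
  have : v \in map tag w by rewrite tw (fintype.subsetP KL).
  by case/mapP => s sw' vE; exists s; rewrite // mem_filter -vE vK.
split=> //; first split=> [|v].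
- by apply/allP => s; rewrite mem_filter => /andP[_ /(allP aw)].
- have [vK|vK] := boolP (v \in K); first by rewrite stack_component.
  by apply: sorted_notin; rewrite tK.
move=> v; have [vK|vK] := boolP (v \in K); last first.
  by rewrite (negPf (top_notin _)) // tK.
rewrite stack_component //; apply: cyclically_reduced_top => //.
have [y /and4P[_ yK vy nvy]] := K_nbr vK.
have /mapP[s sw' yE] : y \in map tag w by rewrite tw (fintype.subsetP KL).
apply/mapP; exists s; first by rewrite mem_filter -yE nvy.
by rewrite /mark -yE eq_sym (negPf vy).
Qed.

End Component.

(** [K] is the component of [u] in the complement graph of [L], for a non-adjacent pair [u], [v];
    this pair prevents it from being a singleton. *)
Lemma nonadj_component L : ~ complete e L -> exists K : {set V},
  [/\ K \subset L, K != finset.set0,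
      forall x y, x \in L -> x \notin K -> y \in K -> e y x,
      {in K &, forall x y, connect (nonadj K) x y} &
      forall x, x \in K -> exists y, nonadj K x y].
Proof.
move=> /existsNP[u] /existsNP[v] /not_implyP[uL] /not_implyP[vL] /not_implyP[uv nuv].
pose K : {set V} := [set x | connect (nonadj L) u x]%SET.
have uK : u \in K by rewrite inE.
have step x y : x \in K -> nonadj L x y -> y \in K.
  by rewrite !inE => ux xy; apply: connect_trans ux (connect1 xy).
have KL : K \subset L.
  apply/fintype.subsetP => x; rewrite inE => /connectP[p].
  elim/last_ind: p x => [|p y _] x; first by move=> _ ->.
  by rewrite rcons_path last_rcons => /andP[_ /and4P[_ yL _ _]] ->.
have sub x y : x \in K -> nonadj L x y -> nonadj K x y.
  move=> xK xy; have yK := step _ _ xK xy.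
  by case/and4P: xy => _ _ h1 h2; rewrite /nonadj xK yK h1.
have conn x : x \in K -> connect (nonadj K) u x.
  rewrite inE => /connectP[p].
  elim/last_ind: p x => [|p y IHp] x; first by move=> _ ->; exact: connect0.
  rewrite rcons_path last_rcons => /andP[pp ly] ->.
  apply: connect_trans (IHp _ pp erefl) (connect1 _); apply: sub ly.
  by rewrite inE; apply/connectP; exists p.
have csym : connect_sym (nonadj K).
  apply: sym_connect_sym => x y; rewrite /nonadj e_sym eq_sym.
  by rewrite andbCA.
have uvL : nonadj L u v by rewrite /nonadj uL vL uv; apply/negP.
exists K; split=> //; first by apply/set0Pn; exists u.
- move=> x y xL xK yK; have yL := fintype.subsetP KL _ yK.
  have yx : y != x by apply: contraNneq xK => <-.
  apply: contraNT xK => nyx; apply: step yK _.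
  by apply/and4P.
- move=> x y /conn ux /conn uy; apply: connect_trans uy.
  by rewrite csym.
move=> x xK; have /connectP[[|y p]] : connect (nonadj K) x u by rewrite csym conn.
  by move=> _ /= <-; exists v; exact: sub.
by move=> /= /andP[xy _] _; exists y.
Qed.

Lemma finite_common_link (K L : {set V}) w u :
  K \subset L -> axial K w -> u \in K ->
  (forall x y, x \in L -> x \notin K -> y \in K -> e y x) ->
  ~ (exists J : {set V}, large_join e G J /\ L \subset J) ->
  finite_set [set x | supported (common_link K) x].
Proof.
move=> KL aw uK K_adj nj; apply: contrapT => inf; apply: nj.
have linkE x : x \in common_link K -> forall y, y \in K -> e y x.
  by rewrite inE => /'forall_implyP.
exists (K :|: common_link K)%SET; split; last first.
  apply/fintype.subsetP => x xL; rewrite finset.in_setU.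
  have [//|xK] := boolP (x \in K); rewrite /= inE.
  by apply/'forall_implyP => y; apply: K_adj.
exists K, (common_link K); split=> //.
- split.
  + by apply/set0Pn; exists u.
  + apply/set0Pn; apply: contrapT => no; apply: inf.
    apply: (sub_finite_set _ (finite_set1 (1 : gp))) => x [[|s s'] /=].
      by move=> _ <-.
    by move=> /andP[sK _] _; case: no; exists (tag s).
  + rewrite -setI_eq0; apply/eqP/finset.setP => x; rewrite !finset.inE.
    apply/negP => /andP[xK /'forall_implyP/(_ x xK)]; by rewrite e_irr.
  + by move=> x y xK /linkE; apply.
- exact: axial_infinite aw uK.
- by move=> fin; apply: inf; apply: sub_finite_set fin; exact: supported_parabolic.
Qed.

Lemma essential_gates (S : forall u, set (G u))
    (genS : generates (@gp_gens V e G S)) (g : gp) (L : {set V}) :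
  has_essential_support g L -> ~ complete e L ->
  ~ (exists J : {set V}, large_join e G J /\ L \subset J) ->
  exists (y : gp) u N (a : G u) C, let z := (g ^ y) ^+ N in
  [/\ (0 < N)%N, a <> 1,
      forall q, supported (star u) q -> hd u (z * q) = a,
      forall q, supported (star u) q -> hd u (z^-1 * q) = 1 &
      forall q, supported (star u) q -> exists c y : gp,
        [/\ z * q = c * y, supported (star u) c, headless (star u) y &
            (cayley_dist genS 1 c <= C)%N]].
Proof.
move=> [y [[w [cw wE]] [w' [gw' w'E w'L]]]] ncL nj; exists y.
have rw : reduced w.
  by apply: graphically_reduced_red => w1 /cmove_emove; exact: cw.
(* [L] is read off another reduced word for the same conjugate; equal normal forms have the same
   vertices. *)
have tw : map tag w =i L.
  move=> v; rewrite (red_tags rw (graphically_reduced_red gw')) ?wE //.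
  by rewrite -w'L inE.
have wL : over L w by apply/allP => s sw; rewrite -tw map_f.
have [K [KL K0 K_adj K_conn K_nbr]] := nonadj_component ncL.
have aK := axial_component KL K_adj K_nbr rw cw tw.
have [wK [f [wKE pf wf]]] := component_split K_adj wL; rewrite -{}wKE in aK.
case: wK aK wf => [|[u b] wK] aK wf.
  have [x xK] := set0Pn _ K0; case: aK => _ /(_ x).
  by rewrite xK.
have uK : u \in K by case: aK => _ <- _; exact: mem_head.
have fin := finite_common_link KL aK uK K_adj nj.
have tu : top (stack u (syl b :: wK)) by rewrite stack_consl.
have [N [a [C H]]] := axial_gates K_conn K_nbr genS aK uK tu pf fin.
by exists u, N, a, C; rewrite -wE wf.
Qed.

End NormalForm.

Theorem theorem5p5 (R : realType) (V : finType) (e : rel V)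
    (e_sym : symmetric e) (e_irr : irreflexive e)
    (G : V -> groupType) (G_nontrivial : forall u, exists a : G u, a <> 1%g)
    (S : forall u, set (G u)) (S_fin : forall u, finite_set (S u))
    (S_gen : forall u, generates (S u))
    (g : graph_product e G) (L : {set V}) :
  has_essential_support g L ->
  ~ complete e L ->
  ~ (exists J : {set V}, large_join e G J /\ L \subset J) ->
  contracting (cayley_action R (gp_gens_generates e S_gen)) g.
Proof.
move=> gL ncL njL; set genS := gp_gens_generates e S_gen.
have [y [u [N [a [C]]]]] := essential_gates e_sym e_irr genS gL ncL njL.
set z := (g ^ y) ^+ N; case=> N0 a1 hR hL gates.
(* [loc k] is the isometry carrying the [k]-th wall, whose carrier is the translate of [star u] by
   [y * zexpg z k], to that of [star u], and the corresponding orbit point to [1]. *)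
pose loc (k : int) (x : graph_product e G) := zexpg z (- k)%R * (y^-1 * x).
have locS k x : loc (k + 1)%R x = z^-1 * loc k x.
  by rewrite /loc opprD addrC zexpgD -mulgA zexpgN.
have orbE k : zexpg g (N%:Z * k)%R * y = y * zexpg z k.
  by rewrite zexpgX zexpg_conj conjgE mulVKg.
have loc_orb k m : loc m (zexpg g (N%:Z * k)%R * y) = zexpg z (k - m)%R.
  by rewrite /loc orbE mulKg -zexpgD addrC.
have loc_dist k x x' : cayley_dist genS (loc k x) (loc k x') = cayley_dist genS x x'.
  by rewrite /loc !cayley_dist_mul.
(* Sector [1] is the strict left side of a wall; the next carrier lies in sector [a]. *)
apply: (@walls_contracting _ _ genS g y N (C + C)
  (fun k x => hd u (loc k x) <> 1)) => //.
- move=> k x; rewrite locS => h h1; apply: h.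
  by apply: (hd_nested e_sym e_irr genS hR hL); rewrite h1; exact: nesym.
- move=> k x x'; rewrite locS => h xx'.
  apply: (hd_step e_sym e_irr genS a1 hR hL h).
  have : cayley_walk (gp_gens S) 1 x x' by exists x'.
  move=> /(cayley_walk_mul y^-1) /(cayley_walk_mul (zexpg z (- k)%R)).
  by case=> t + tE; rewrite tE.
- move=> k x x' /contrapT hx; rewrite locS => hx'.
  have xa : hd u (loc k x) <> a by rewrite hx; exact: nesym.
  have := bottleneck e_sym e_irr hR hL gates xa hx'.
  have <- : loc k (zexpg g (N%:Z * k)%R * y) = 1 by rewrite loc_orb subrr.
  by rewrite !loc_dist.
- by move=> k; rewrite loc_orb opprB addrC subrK /= -[z]mulg1 hR //; exact: supported1.
- move=> k; rewrite loc_orb opprD addrA subrr add0r zexpgN /= -[z^-1]mulg1 hL //.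
  exact: supported1.
Qed.
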